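(* Under the standing assumptions in the context, let $\{\mu_{i,t}:t\in I,\ i=1,\dots,m\}$ be any evolution system of measures associated with $\mathbf G(t,s)$. Assume that $\mathbf G(t_0,s)$ is compact in $C_b(\mathbb R^d;\mathbb R^m)$ for some $s<t_0$ in $I$. Then $\mathbf G(t_0,s)$ is compact from $L^p_{\boldsymbol\mu_s}(\mathbb R^d;\mathbb R^m)$ into $L^p_{\boldsymbol\mu_{t_0}}(\mathbb R^d;\mathbb R^m)$ for every $p\in(1,+\infty)$.
   Context: Let $d,m$ be positive integers and let $I$ be either an open right half-line or $I=\mathbb R$. For $t\in I$, $\boldsymbol{\mathcal A}(t)$ acts on smooth $\boldsymbol\psi:\mathbb R^d\to\mathbb R^m$ by $(\boldsymbol{\mathcal A}(t)\boldsymbol\psi)_k(x)=\mathrm{Tr}(Q^k(t,x)D^2\psi_k(x))+\langle \mathbf b^k(t,x),\nabla\psi_k(x)\rangle+(C(t,x)\boldsymbol\psi(x))_k$, $k=1,\dots,m$, with $Q^k=(q^k_{ij})$, $\mathbf b^k=(b^k_j)$, $C=(c_{hk})$. Inequalities between vectors are componentwise. Standing assumptions: (i) $q^k_{ij}=q^k_{ji}$, $b^k_j$, $c_{hk}$ belong to $C^{\alpha/2,\alpha}_{\rm loc}(I\times\mathbb R^d)$ for some $\alpha\in(0,1)$ (parabolic Hölder space on compact sets), and $C\not\equiv0$; (ii) for every $k$ the infimum over $I\times\mathbb R^d$ of the minimum eigenvalue of $Q^k(t,x)$ is positive; (iii) there is no nonempty proper set $K'\subset\{1,\dots,m\}$ with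 $c_{ij}\equiv0$ on $I\times\mathbb R^d$ for all $i\in K'$, $j\notin K'$; (iv) for every bounded $J\subset I$ there exist $\boldsymbol\varphi_J\in C^2(\mathbb R^d;\mathbb R^m)$ with positive components, each blowing up as $|x|\to+\infty$, and $\lambda_J>0$ with $\boldsymbol{\mathcal A}(t)\boldsymbol\varphi_J\le\lambda_J\boldsymbol\varphi_J$ in $\mathbb R^d$ for all $t\in J$; (v) each row sum of $C$ is bounded from above on $I\times\mathbb R^d$; (vi) the off-diagonal entries of $C$ are nonnegative. Evolution operator: under these assumptions, for every $\mathbf f\in C_b(\mathbb R^d;\mathbb R^m)$ (bounded continuous) and $s\in I$, the problem $D_t\mathbf u=\boldsymbol{\mathcal A}(t)\mathbf u$ in $(s,+\infty)\times\mathbb R^d$, $\mathbf u(s,\cdot)=\mathbf f$, has a unique solution $\mathbf u$ belonging to $C_b([s,T]\times\mathbb R^d;\mathbb R^m)\cap C^{1+\alpha/2,2+\alpha}_{\rm loc}((s,+\infty)\times\mathbb R^d;\mathbb R^m)$ for every $T>s$; one sets $\mathbf G(t,s)\mathbf f=\mathbf u(t,\cdot)$. An evolution system of measures associated with $\mathbf G(t,s)$ is a family $\{\mu_{i,r}:r\in I,\ i=1,\dots,m\}$ of positive and finite Borel measures on $\mathbb R^d$ such that $\sum_{i=1}^m\int_{\mathbb R^d}(\mathbf G(t,s)\mathbf f)_i\,d\mu_{i,t}=\sum_{i=1}^m\int_{\mathbb R^d}f_i\,d\mu_{i,s}$ for all $\mathbf f\in C_b(\mathbb R^d;\mathbb R^m)$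 and all $s<t$ in $I$. For $p\in[1,+\infty)$, $L^p_{\boldsymbol\mu_t}(\mathbb R^d;\mathbb R^m)$ is the space of $\mathbf f$ with $f_i\in L^p_{\mu_{i,t}}(\mathbb R^d)$, with norm $(\sum_{i=1}^m\int_{\mathbb R^d}|f_i|^pd\mu_{i,t})^{1/p}$. For $t>s$, $\mathbf G(t,s)$ extends from $C_b(\mathbb R^d;\mathbb R^m)$ to a bounded operator from $L^p_{\boldsymbol\mu_s}(\mathbb R^d;\mathbb R^m)$ into $L^p_{\boldsymbol\mu_t}(\mathbb R^d;\mathbb R^m)$, still denoted $\mathbf G(t,s)$. *)

(* Defs.v *)
From HB Require Import structures.
From mathcomp Require Import all_boot all_order all_algebra.
From mathcomp Require Import ring.
From mathcomp Require Import all_classical all_reals all_analysis measurable_realfun.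
Set Implicit Arguments.
Unset Strict Implicit.
Unset Printing Implicit Defensive.
Import Order.TTheory GRing.Theory Num.Theory.
Import numFieldNormedType.Exports.
Local Open Scope classical_set_scope.
Local Open Scope ring_scope.

Definition compact_operator (K : realType) (V W : normedModType K)
    (T : V -> W) : Prop :=
  forall A : set V, bounded_set A -> precompact (T @` A).

Definition bounded_linear_operator (K : realType) (V W : normedModType K)
    (T : V -> W) : Prop :=
  linear T /\ exists M : K, forall f, `|T f| <= M * `|f|.

(* The normed space [V / {N = 0}] of a seminorm [N] on [V]. *)
Record seminorm (K : realType) (V : lmodType K) := Seminorm {
  seminorm_fun :> V -> K ;
  ler_seminormD : forall x y,
    seminorm_fun (x + y) <= seminorm_fun x + seminorm_fun y ;
  seminormZ : forall (a : K) x, seminorm_fun (a *: x) = `|a| * seminorm_fun x }.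

Section seminorm_quotient.
Context (K : realType) (V : lmodType K) (N : seminorm V).

Lemma seminorm0 : N 0 = 0.
Proof. by rewrite -(scale0r 0) seminormZ normr0 mul0r. Qed.

Lemma seminormN x : N (- x) = N x.
Proof. by rewrite -scaleN1r seminormZ normrN1 mul1r. Qed.

Lemma seminorm_ge0 x : 0 <= N x.
Proof.
have := ler_seminormD N x (- x).
by rewrite subrr seminorm0 seminormN -mulr2n pmulrn_lge0.
Qed.

Definition seminorm_null : {pred V} := fun x => N x == 0.

Lemma seminorm_null_zmod_closed : zmod_closed seminorm_null.
Proof.
split=> [|x y /eqP x0 /eqP y0]; first by rewrite unfold_in seminorm0.
rewrite unfold_in eq_le seminorm_ge0 andbT.
by rewrite (le_trans (ler_seminormD _ _ _))// seminormN x0 y0 addr0.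
Qed.
HB.instance Definition _ :=
  GRing.isZmodClosed.Build V seminorm_null seminorm_null_zmod_closed.

Definition seminorm_quot : Type := Quotient.quot seminorm_null.
HB.instance Definition _ := ZmodQuotient.on seminorm_quot.

Local Open Scope quotient_scope.

Lemma seminorm_quotD x y :
  \pi_seminorm_quot (x + y) = \pi_seminorm_quot x + \pi_seminorm_quot y.
Proof. by rewrite Quotient.pi_add. Qed.

Lemma seminorm_quotP x y :
  reflect (\pi_seminorm_quot x = \pi_seminorm_quot y) (N (x - y) == 0).
Proof.
by apply: (iffP idP) => [xy|/eqP]; [apply/eqP; rewrite -Quotient.idealrBE|
  rewrite -Quotient.idealrBE].
Qed.

Definition seminorm_quot_norm (x : seminorm_quot) : K := N (repr x).

Lemma seminorm_quot_normE x : seminorm_quot_norm (\pi_seminorm_quot x) = N x.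
Proof.
rewrite /seminorm_quot_norm; set y := repr _.
have le_eq u v : N (u - v) == 0 -> N u <= N v.
  by move=> /eqP uv; rewrite -(subrK v u) (le_trans (ler_seminormD _ _ _))// uv add0r.
have yx : N (y - x) == 0 by apply/seminorm_quotP; rewrite reprK.
apply/eqP; rewrite eq_le !le_eq//.
by rewrite -seminormN opprB.
Qed.

Definition seminorm_quot_scale (a : K) (x : seminorm_quot) : seminorm_quot :=
  \pi_seminorm_quot (a *: repr x).

Lemma seminorm_quot_scaleE a x :
  seminorm_quot_scale a (\pi_seminorm_quot x) = \pi_seminorm_quot (a *: x).
Proof.
apply/seminorm_quotP; rewrite -scalerBr seminormZ mulf_eq0; apply/orP; right.
by apply/seminorm_quotP; rewrite reprK.
Qed.

Let scaleA a b v :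
  seminorm_quot_scale a (seminorm_quot_scale b v) =
  seminorm_quot_scale (a * b) v.
Proof.
by rewrite -[v]reprK (seminorm_quot_scaleE b) (seminorm_quot_scaleE a)
  (seminorm_quot_scaleE (a * b)) scalerA.
Qed.
Let scale1 : left_id 1 seminorm_quot_scale.
Proof. by move=> v; rewrite -[v]reprK seminorm_quot_scaleE scale1r. Qed.
Let scaleDr : right_distributive seminorm_quot_scale +%R.
Proof.
move=> a u v; rewrite -[u]reprK -[v]reprK -seminorm_quotD !seminorm_quot_scaleE.
by rewrite scalerDr seminorm_quotD.
Qed.
Let scaleDl v : {morph seminorm_quot_scale^~ v : a b / a + b}.
Proof.
by move=> a b; rewrite -[v]reprK !seminorm_quot_scaleE scalerDl seminorm_quotD.
Qed.
HB.instance Definition _ := GRing.Zmodule_isLmodule.Build K seminorm_quot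
  scaleA scale1 scaleDr scaleDl.

Let normD x y :
  seminorm_quot_norm (x + y) <= seminorm_quot_norm x + seminorm_quot_norm y.
Proof.
rewrite -[x]reprK -[y]reprK -seminorm_quotD !seminorm_quot_normE.
exact: ler_seminormD.
Qed.
Let normZ (a : K) x :
  seminorm_quot_norm (a *: x) = `|a| * seminorm_quot_norm x.
Proof.
by rewrite -[x]reprK [a *: _]seminorm_quot_scaleE !seminorm_quot_normE seminormZ.
Qed.
Let norm0_eq0 x : seminorm_quot_norm x = 0 -> x = 0.
Proof.
rewrite -[x]reprK seminorm_quot_normE => x0; have -> : 0 = \pi_seminorm_quot (0 : V) by rewrite pi_zeror.
by apply/seminorm_quotP; rewrite subr0 x0.
Qed.
HB.instance Definition _ :=
  Lmodule_isNormed.Build K seminorm_quot normD normZ norm0_eq0.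

End seminorm_quotient.


Section bounded_continuous.
Context (R : realType) (d m : nat).

Definition Cb_pred : {pred ('rV[R]_d -> 'rV[R]_m)} :=
  fun f => `[< continuous f /\ exists M : R, forall x, `|f x| <= M >].

Lemma Cb_submod_closed : submod_closed Cb_pred.
Proof.
split=> [|a f g /asboolP[cf bf] /asboolP[cg bg]]; apply/asboolP.
  by split; [exact: cst_continuous|exists 0 => x; rewrite normr0].
have [M fM] := bf; have [M' gM] := bg.
split=> [x|].
  apply: (@continuousD _ _ _ (a *: f) g); last exact: cg.
  by apply: continuousZl_tmp; exact: cf.
exists (`|a| * M + M') => x.
rewrite (le_trans (ler_normD _ _))// lerD ?gM//.
by rewrite normrZ ler_wpM2l// fM.
Qed.
HB.instance Definition _ :=
  GRing.isSubmodClosed.Build R _ Cb_pred Cb_submod_closed.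

(* The norm of ['rV_n] is the max norm; all the notions below depend only on
   its equivalence class. *)
Record Cb := MkCb { Cb_fun :> 'rV[R]_d -> 'rV[R]_m ; _ : Cb_fun \in Cb_pred }.
HB.instance Definition _ := [isSub for Cb_fun].
HB.instance Definition _ := [Choice of Cb by <:].
HB.instance Definition _ := [SubChoice_isSubLmodule of Cb by <:].

Lemma Cb_continuous (f : Cb) : continuous f.
Proof. by have /asboolP[] := valP f. Qed.

Lemma Cb_bounded (f : Cb) : exists M : R, forall x, `|f x| <= M.
Proof. by have /asboolP[] := valP f. Qed.

Definition Cb_norm (f : Cb) : R := sup [set `|f x| | x in [set: 'rV[R]_d]].

Lemma Cb_norm_has_sup (f : Cb) : has_sup [set `|f x| | x in [set: 'rV[R]_d]].
Proof.
split; first by exists `|f 0|, 0.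
have [M fM] := Cb_bounded f.
by exists M => _ [x _ <-]; exact: fM.
Qed.

Lemma ler_Cb_norm (f : Cb) x : `|f x| <= Cb_norm f.
Proof. by apply: ub_le_sup; [case: (Cb_norm_has_sup f)|exists x]. Qed.

Lemma Cb_norm_le (f : Cb) M : (forall x, `|f x| <= M) -> Cb_norm f <= M.
Proof.
move=> fM; apply: ge_sup; first by case: (Cb_norm_has_sup f).
by move=> _ [x _ <-].
Qed.

Let normD f g : Cb_norm (f + g) <= Cb_norm f + Cb_norm g.
Proof.
apply: Cb_norm_le => x.
by rewrite (le_trans (ler_normD _ _))// lerD ?ler_Cb_norm.
Qed.
Let normZ (a : R) f : Cb_norm (a *: f) = `|a| * Cb_norm f.
Proof.
have le b g : Cb_norm (b *: g) <= `|b| * Cb_norm g.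
  by apply: Cb_norm_le => x; rewrite normrZ ler_wpM2l// ler_Cb_norm.
apply/eqP; rewrite eq_le le/=; have [->|a0] := eqVneq a 0.
  by rewrite normr0 mul0r (le_trans _ (ler_Cb_norm _ 0)).
rewrite -ler_pdivlMl ?normr_gt0// -normfV.
by rewrite -{1}(scalerK a0 f).
Qed.
Let norm0_eq0 f : Cb_norm f = 0 -> f = 0.
Proof.
move=> f0; apply/val_inj/funext => x /=.
by apply/eqP; rewrite -normr_le0 -f0 ler_Cb_norm.
Qed.
HB.instance Definition _ := Lmodule_isNormed.Build R Cb normD normZ norm0_eq0.

End bounded_continuous.

Definition borelRd (R : realType) (d : nat) :=
  g_sigma_algebraType (@open 'rV[R]_d).

Section Lp.
Context (R : realType) (d m : nat).
Context (nu : 'I_m -> {finite_measure set (borelRd R d) -> \bar R}).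
Context (p : R) (p1 : 1 <= p).

Let p1e : (1 <= p%:E)%E. Proof. by rewrite lee_fin. Qed.
Let p_gt0 : 0 < p. Proof. exact: lt_le_trans p1. Qed.

(* The phantom argument [1 <= p] lets the closure instance below be inferred. *)
Definition Lp_pred of 1 <= p : {pred ('rV[R]_d -> 'rV[R]_m)} := fun f =>
  `[< forall i, (fun x : borelRd R d => f x ord0 i) \in Lfun (nu i) p%:E >].

Lemma Lp_submod_closed : submod_closed (Lp_pred p1).
Proof.
split=> [|a f g /asboolP fP /asboolP gP]; apply/asboolP => i.
  have -> : (fun x : borelRd R d => (0 : 'rV[R]_d -> 'rV[R]_m) x ord0 i) =
    cst 0 by apply/funext => x; rewrite mxE.
  exact: (Lfun_submod_closed (nu i) p1e).1.
have -> : (fun x : borelRd R d => (a *: f + g) x ord0 i) =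
    a *: (fun x : borelRd R d => f x ord0 i) +
    (fun x : borelRd R d => g x ord0 i) by apply/funext => x; rewrite !mxE.
by apply: (Lfun_submod_closed (nu i) p1e).2.
Qed.
HB.instance Definition _ :=
  GRing.isSubmodClosed.Build R _ (Lp_pred p1) Lp_submod_closed.

Record Lp_fun :=
  MkLp_fun { Lp_fun_val :> 'rV[R]_d -> 'rV[R]_m ; _ : Lp_fun_val \in Lp_pred p1 }.
HB.instance Definition _ := [isSub for Lp_fun_val].
HB.instance Definition _ := [Choice of Lp_fun by <:].
HB.instance Definition _ := [SubChoice_isSubLmodule of Lp_fun by <:].

Definition Lp_seminorm_fun (f : Lp_fun) : R :=
  (\sum_(i < m) \int[nu i]_x (`|f x ord0 i| `^ p)) `^ p^-1.

Lemma Lp_integrable (f : Lp_fun) i :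
  (nu i).-integrable [set: borelRd R d]
    (EFin \o fun x => `|f x ord0 i| `^ p).
Proof.
by have /asboolP/(_ i) := valP f; apply: Lfun_integrable.
Qed.

Let Imass (f : Lp_fun) := \sum_(i < m) \int[nu i]_x (`|f x ord0 i| `^ p).

Let Imass_ge0 f : 0 <= Imass f.
Proof. by apply: sumr_ge0 => i _; apply: Rintegral_ge0 => x _; exact: powR_ge0. Qed.

Let Lp_seminorm_le f a : 0 <= a -> (Lp_seminorm_fun f <= a) = (Imass f <= a `^ p).
Proof.
move=> a0; rewrite /Lp_seminorm_fun -/(Imass f).
apply/idP/idP => h.
  have -> : Imass f = (Imass f `^ p^-1) `^ p.
    by rewrite -powRrM mulVf ?gt_eqF// powRr1.
  by apply: ge0_ler_powR => //; rewrite ?nnegrE ?powR_ge0// ltW.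
have -> : a = (a `^ p) `^ p^-1.
  by rewrite -powRrM mulfV ?gt_eqF// powRr1.
by apply: ge0_ler_powR => //; rewrite ?nnegrE ?powR_ge0// invr_ge0 ltW.
Qed.

Let convex_bound (a b x y : R) : 0 < a -> 0 < b ->
  `|x + y| `^ p <= (a + b) `^ p *
    (a / (a + b) * (`|x| `^ p / a `^ p) + b / (a + b) * (`|y| `^ p / b `^ p)).
Proof.
move=> a0 b0; have ab0 : 0 < a + b by exact: addr_gt0.
have t01 : 0 <= a / (a + b) <= 1.
  apply/andP; split; first by rewrite divr_ge0 ?ltW.
  by rewrite ler_pdivrMr// mul1r lerDl ltW.
case/andP: t01 => t0 t1.
have xa : `|x| / a \in `[0, +oo[%classic.
  by rewrite inE/= in_itv/= andbT divr_ge0// ltW.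
have yb : `|y| / b \in `[0, +oo[%classic.
  by rewrite inE/= in_itv/= andbT divr_ge0// ltW.
have tE : 1 - a / (a + b) = b / (a + b).
  rewrite -[X in X - _](@divff _ (a + b)) ?gt_eqF// -mulrBl.
  by rewrite addrC addKr.
have h : (a / (a + b) * (`|x| / a) + b / (a + b) * (`|y| / b)) `^ p <=
    a / (a + b) * (`|x| / a) `^ p + b / (a + b) * (`|y| / b) `^ p.
  by rewrite -tE; exact: (convex_powR p1 (Itv01 t0 t1) xa yb).
have divX (u c : R) : 0 < c -> (`|u| / c) `^ p = `|u| `^ p / c `^ p.
  move=> c0; apply: (@mulIf _ (c `^ p)); first by rewrite gt_eqF ?powR_gt0.
  rewrite -powRM ?(ltW c0)//; last by rewrite divr_ge0// ltW.
  by rewrite !divfK// gt_eqF// powR_gt0.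
rewrite !divX// in h.
apply: le_trans (ler_wpM2l (powR_ge0 _ _) h).
have w0 : 0 <= a / (a + b) * (`|x| / a) + b / (a + b) * (`|y| / b).
  by rewrite addr_ge0// mulr_ge0// divr_ge0// ltW.
rewrite -powRM ?(ltW ab0)//.
have -> : (a + b) * (a / (a + b) * (`|x| / a) + b / (a + b) * (`|y| / b)) =
    `|x| + `|y| by field; rewrite !gt_eqF.
by apply: ge0_ler_powR; rewrite ?nnegrE ?addr_ge0 ?ler_normD// ltW.
Qed.

Let normD f g : Lp_seminorm_fun (f + g) <= Lp_seminorm_fun f + Lp_seminorm_fun g.
Proof.
apply/ler_addgt0Pr => e e0.
pose a := Lp_seminorm_fun f + e / 2; pose b := Lp_seminorm_fun g + e / 2.
have a0 : 0 < a by rewrite ltr_wpDl ?powR_ge0// divr_gt0.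
have b0 : 0 < b by rewrite ltr_wpDl ?powR_ge0// divr_gt0.
have fa : Imass f <= a `^ p.
  by rewrite -(Lp_seminorm_le _ (ltW a0)) lerDl ltW// divr_gt0.
have gb : Imass g <= b `^ p.
  by rewrite -(Lp_seminorm_le _ (ltW b0)) lerDl ltW// divr_gt0.
have -> : Lp_seminorm_fun f + Lp_seminorm_fun g + e = a + b.
  by rewrite /a /b addrACA -splitr.
clearbody a b; have ab0 : 0 < a + b by rewrite addr_gt0.
rewrite (Lp_seminorm_le _ (ltW ab0)).
pose c1 := (a + b) `^ p * (a / (a + b)) / a `^ p.
pose c2 := (a + b) `^ p * (b / (a + b)) / b `^ p.
have c10 : 0 <= c1 by rewrite !mulr_ge0 ?invr_ge0 ?powR_ge0// ltW.
have c20 : 0 <= c2 by rewrite !mulr_ge0 ?invr_ge0 ?powR_ge0// ltW.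
have step : Imass (f + g) <= c1 * Imass f + c2 * Imass g.
  rewrite !mulr_sumr -big_split/=; apply: ler_sum => i _.
  have If := integrableZl measurableT c1 (Lp_integrable f i).
  have Ig := integrableZl measurableT c2 (Lp_integrable g i).
  rewrite -!RintegralZl ?Lp_integrable// -RintegralD//.
  apply: le_Rintegral => //; first exact: Lp_integrable.
    exact: (integrableD measurableT If Ig).
  move=> x _; rewrite mxE.
  apply: le_trans (convex_bound _ _ a0 b0) _.
  rewrite le_eqVlt; apply/orP; left; apply/eqP.
  by rewrite /c1 /c2; ring.
apply: le_trans step _.
apply: (@le_trans _ _ (c1 * a `^ p + c2 * b `^ p)).
  by rewrite lerD// ler_wpM2l.
rewrite /c1 /c2 !divfK ?gt_eqF ?powR_gt0// -mulrDr -mulrDl divff ?gt_eqF//.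
by rewrite mulr1.
Qed.

Let normZ (a : R) f : Lp_seminorm_fun (a *: f) = `|a| * Lp_seminorm_fun f.
Proof.
rewrite /Lp_seminorm_fun.
have -> : \sum_(i < m) \int[nu i]_x (`|(a *: f) x ord0 i| `^ p) =
    `|a| `^ p * \sum_(i < m) \int[nu i]_x (`|f x ord0 i| `^ p).
  rewrite mulr_sumr; apply: eq_bigr => i _.
  rewrite -RintegralZl ?Lp_integrable//.
  by apply: eq_Rintegral => x _; rewrite mxE normrM powRM.
by rewrite (powRM _ (powR_ge0 _ _) (Imass_ge0 f)) -powRrM mulfV ?gt_eqF// powRr1.
Qed.

Definition Lp_seminorm : seminorm Lp_fun := Seminorm normD normZ.

(* [Lp_seminorm f = 0] iff [f x ord0 i = 0] for [nu i]-almost every [x], for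
   every [i], so the quotient identifies functions that are equal a.e. *)
Definition Lp : Type := seminorm_quot Lp_seminorm.
HB.instance Definition _ := NormedModule.on Lp.

Definition Lp_class (f : Lp_fun) : Lp := \pi_(seminorm_quot Lp_seminorm)%qT f.

Lemma Cb_measurable (f : Cb R d m) i :
  measurable_fun [set: borelRd R d] (fun x : borelRd R d => f x ord0 i).
Proof.
apply: (measurability _ (RGenOInfty.measurableE R)) => // _ [_ [a ->] <-].
rewrite setTI; apply: sub_sigma_algebra.
have cf : continuous (fun x : 'rV[R]_d => f x ord0 i).
  move=> x; apply: (@continuous_comp _ _ _ f (fun y : 'rV[R]_m => y ord0 i)).
    exact: Cb_continuous.
  exact: coord_continuous.
by move/continuousP : cf; apply; exact: interval_open.
Qed.

Lemma Cb_Lp_pred (f : Cb R d m) : (f : 'rV[R]_d -> 'rV[R]_m) \in Lp_pred p1.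
Proof.
apply/asboolP => i; have mf := Cb_measurable f i.
have [M fM] := Cb_bounded f.
rewrite inE/=; apply/andP; split; rewrite inE//= /finite_norm unlock poweR_lty//.
apply: (@le_lt_trans _ _ (\int[nu i]_x (M `^ p)%:E)%E); last first.
  by apply: integrable_lty => //; exact: finite_measure_integrable_cst.
apply: ge0_le_integral => //=.
- apply/measurable_EFinP; apply: (measurableT_comp (measurable_powR p)) => //.
  exact: measurableT_comp.
- move=> x _; rewrite lee_fin.
  have fxM : `|f x ord0 i| <= M.
    apply: le_trans (fM x); rewrite [leRHS]/Num.norm/= mx_normrE.
    by apply: (le_bigmax _ (fun ij => `|f x ij.1 ij.2|) (ord0, i)).
  apply: ge0_ler_powR => //; rewrite ?nnegrE ?(le_trans _ fxM)//.
  exact: ltW.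
Qed.

Definition Cb_to_Lp (f : Cb R d m) : Lp := Lp_class (MkLp_fun (Cb_Lp_pred f)).

End Lp.

Section parabolic_system.
Context (R : realType) (d m : nat).
Local Notation E := 'rV[R]_d.
Local Notation V := 'rV[R]_m.

Definition partial (i : 'I_d) (g : E -> R) : E -> R :=
  'D_(delta_mx ord0 i) g.

Definition hessian (g : E -> R) (x : E) : 'M[R]_d :=
  \matrix_(i, j) partial i (partial j g) x.

Definition C2 (g : E -> R) : Prop :=
  [/\ continuous g,
      forall i x, derivable g x (delta_mx ord0 i),
      forall i, continuous (partial i g),
      forall i j x, derivable (partial j g) x (delta_mx ord0 i) &
      forall i j, continuous (partial i (partial j g))].

Definition parabolic_holder_loc (alpha : R) (D : set (R * E))
    (g : R -> E -> R) : Prop :=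
  forall K : set (R * E), compact K -> K `<=` D ->
    exists M : R, forall z w, K z -> K w ->
      `|g z.1 z.2 - g w.1 w.2| <=
      M * (`|z.1 - w.1| `^ (alpha / 2) + `|z.2 - w.2| `^ alpha).

Definition parabolic_holder12_loc (alpha : R) (D : set (R * E))
    (g : R -> E -> R) : Prop :=
  [/\ forall t x, D (t, x) ->
        [/\ derivable (g ^~ x) t 1,
            forall i, derivable (g t) x (delta_mx ord0 i) &
            forall i j, derivable (partial j (g t)) x (delta_mx ord0 i)],
      {within D, continuous (fun z => g z.1 z.2)},
      forall i, {within D, continuous (fun z => partial i (g z.1) z.2)},
      parabolic_holder_loc alpha D (fun t x => derive1 (g ^~ x) t) &
      forall i j,
        parabolic_holder_loc alpha D (fun t => partial i (partial j (g t)))].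

Section coefficients.
Context (I : set R) (q : 'I_m -> R -> E -> 'M[R]_d)
  (b : 'I_m -> R -> E -> 'rV[R]_d) (C : R -> E -> 'M[R]_m).

Definition elliptic_operator (t : R) (psi : E -> V) (x : E) : V :=
  \row_k (let psik := fun y => psi y ord0 k in
    \tr (q k t x *m hessian psik x)
    + \sum_j b k t x ord0 j * partial j psik x
    + \sum_h C t x k h * psi x ord0 h).

(* The spectrum of a symmetric matrix of positive size is finite and nonempty,
   so this infimum is a minimum. *)
Definition min_eigenvalue (A : 'M[R]_d) : R :=
  inf [set a | eigenvalue A a].

Record standing_assumptions (alpha : R) : Prop := {
  alpha_itv : 0 < alpha < 1 ;
  q_sym : forall k t x, I t -> (q k t x)^T = q k t x ;
  q_holder : forall k i j,
    parabolic_holder_loc alpha (I `*` setT) (fun t x => q k t x i j) ;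
  b_holder : forall k j,
    parabolic_holder_loc alpha (I `*` setT) (fun t x => b k t x ord0 j) ;
  C_holder : forall h k,
    parabolic_holder_loc alpha (I `*` setT) (fun t x => C t x h k) ;
  C_neq0 : exists t x, I t /\ C t x <> 0 ;
  q_elliptic : forall k,
    (0 < ereal_inf [set (min_eigenvalue (q k z.1 z.2))%:E
                   | z in I `*` [set: E]])%E ;
  C_irreducible : ~ exists K : {set 'I_m},
    (0 < #|K| < m)%N /\
    forall i j, i \in K -> j \notin K -> forall t x, I t -> C t x i j = 0 ;
  lyapunov : forall J : set R, J `<=` I -> bounded_set J ->
    exists (phi : E -> V) (lambda : R),
      [/\ forall k, C2 (fun x => phi x ord0 k),
          forall k x, 0 < phi x ord0 k,
          forall k (M : R), exists r : R,
            forall x, r < `|x| -> M < phi x ord0 k,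
          0 < lambda &
          forall t x k, J t ->
            elliptic_operator t phi x ord0 k <= lambda * phi x ord0 k] ;
  C_rowsum : forall i, exists M : R,
    forall t x, I t -> \sum_j C t x i j <= M ;
  C_offdiag : forall i j t x, i != j -> I t -> 0 <= C t x i j }.

Definition cauchy_solution (alpha s : R) (f : E -> V) (u : R -> E -> V) : Prop :=
  [/\ forall T, s < T ->
        {within `[s, T] `*` [set: E], continuous (fun z => u z.1 z.2)} /\
        exists M : R, forall t x, s <= t <= T -> `|u t x| <= M,
      forall k, parabolic_holder12_loc alpha (`]s, +oo[ `*` [set: E])
        (fun t x => u t x ord0 k),
      forall t x k, s < t ->
        derive1 (fun r => u r x ord0 k) t =
        elliptic_operator t (u t) x ord0 k &
      u s = f].

Definition evolution_operator (alpha : R)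
    (G : R -> R -> Cb R d m -> Cb R d m) : Prop :=
  forall s (f : Cb R d m), I s ->
    cauchy_solution alpha s f (fun t => G t s f) /\
    forall v, cauchy_solution alpha s f v -> forall t, s <= t -> v t = G t s f.

End coefficients.

Definition evolution_system_of_measures (I : set R)
    (G : R -> R -> Cb R d m -> Cb R d m)
    (mu : R -> 'I_m -> {finite_measure set (borelRd R d) -> \bar R}) : Prop :=
  forall (f : Cb R d m) s t, I s -> I t -> s < t ->
    \sum_i \int[mu t i]_x (G t s f x ord0 i) = \sum_i \int[mu s i]_x f x ord0 i.

(* Bounded continuous functions are dense in [Lp (mu s) p1], so the extension
   [Gp p p1 t s] of [G t s] is unique. *)
Definition Lp_extension (I : set R) (G : R -> R -> Cb R d m -> Cb R d m)
    (mu : R -> 'I_m -> {finite_measure set (borelRd R d) -> \bar R})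
    (Gp : forall (p : R) (p1 : 1 <= p) (t s : R),
      Lp (mu s) p1 -> Lp (mu t) p1) : Prop :=
  forall p (p1 : 1 <= p) t s, I s -> I t -> s < t ->
    bounded_linear_operator (Gp p p1 t s) /\
    forall f : Cb R d m,
      Gp p p1 t s (Cb_to_Lp (mu s) p1 f) = Cb_to_Lp (mu t) p1 (G t s f).

End parabolic_system.

(* Main.v *)
Require Import Defs.
From mathcomp Require Import all_boot all_order all_algebra.
From mathcomp Require Import all_classical all_reals all_analysis.
From mathcomp Require Import measurable_realfun ring lra.
Import Order.TTheory GRing.Theory Num.Theory.
Import numFieldNormedType.Exports.
Local Open Scope classical_set_scope.
Local Open Scope ring_scope.

(** Write T for the operator on bounded continuous functions, nu and mu for the
    measures at the initial and final times.  The argument rests on three facts: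
    T is compact for the sup norm, it is bounded and linear from L1(nu) to
    L1(mu), and its extension is bounded and linear from Lp(nu) to Lp(mu).  The
    conclusion is then a one-sided compact interpolation theorem, proved by
    truncation.

    Split f = clamp K f + (f - clamp K f), where clamp truncates each component
    at height K.  The first part stays in a sup-norm ball, so its image under T
    stays in a compact set of continuous functions, which is also compact in
    Lp(mu).  It remains to see that T (f - clamp K f) is small in Lp(mu),
    uniformly over f with bounded Lp(nu) norm, when K is large ([compact_tail]).

    Two ingredients give this.  First, on functions of sup norm at most 1, a small
    L1(nu) norm forces T to be uniformly small almost everywhere
    ([excess_mass_small]): a cluster point in the sup norm of images of functions
    tending to 0 in L1(nu) is null in L1(mu).  Applied to the truncations of the
    tail g = f - clamp K f, which live where |f| > K, it says
    that T (clamp l g) is at most w l for every l, with a small w.  Second, a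
    Marcinkiewicz-type argument ([truncated_interpolation]): with (y)_+ the
    positive part, T g splits as T (clamp l g) + T (g - clamp l g), hence
      int (|T g| - w l)_+ dmu <= int |T (g - clamp l g)| dmu
                              <= C int (|g| - l)_+ dnu,
    and |y|^p is, up to constants, a positive superposition of the functions
    (|y| - l)_+ with weights l^(p-1) over dyadic l.  Summing over l yields
      int |T g|^p dmu <= const * C * w^(p-1) * int |g|^p dnu,
    which is small because p > 1.

    To pass from this to compactness one needs that bounded continuous functions
    are dense in Lp ([Cb_dense_Lp]), that Lp is complete along geometrically
    converging sequences ([Lp_geometric_complete]), and that in such a space a set
    which is uniformly close to compact sets is precompact
    ([precompact_approx]). *)

(** * Powers as superpositions of truncated excesses *)

Section dyadic.
Context {R : realType}.
Implicit Types (x l u v p : R).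

Definition excess l x := Num.max (`|x| - l) 0.

Lemma excess_ge0 l x : 0 <= excess l x.
Proof. by rewrite le_max lexx orbT. Qed.

Lemma excess_le l x : 0 <= l -> excess l x <= `|x|.
Proof. by move=> l0; rewrite ge_max normr_ge0 lerBlDr lerDl l0. Qed.

Lemma excessD l u v : excess l (u + v) <= excess l u + `|v|.
Proof.
rewrite ge_max addr_ge0 ?excess_ge0// andbT.
have : `|u| - l <= excess l u by rewrite le_max lexx.
by have := ler_normD u v; lra.
Qed.

Lemma excessM l c x : 0 <= c -> excess (c * l) (c * x) = c * excess l x.
Proof. by move=> c0; rewrite /excess normrM ger0_norm// -mulrBr maxr_pMr// mulr0. Qed.

(** A discrete form of the integral over h > 0 of h^(p-2) (|x| - h)_+, which is a
    multiple of |x|^p; being a finite sum, it commutes with integrals without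
    Fubini's theorem. *)
Definition dyadic_sum p l n x :=
  \sum_(k < n) (l * 2 ^+ k) `^ (p - 1) * excess (l * 2 ^+ k) x.

Lemma dyadic_sum_ge0 p l n x : 0 <= dyadic_sum p l n x.
Proof. by apply: sumr_ge0 => k _; rewrite mulr_ge0 ?powR_ge0 ?excess_ge0. Qed.

(** The node of the grid lying between |x|/4 and |x|/2 already contributes a
    multiple of |x|^p.  Values of |x| below twice the first node are charged to
    the additive error, which vanishes as the grid is refined towards 0. *)
Lemma dyadic_sum_lower p l n x : 1 <= p -> 0 < l -> `|x| <= l * 2 ^+ n ->
  `|x| `^ p <= (2 * l) `^ p + 2 * 4 `^ (p - 1) * dyadic_sum p l n x.
Proof.
move=> p1 l0; have p0 : 0 <= p by rewrite (le_trans _ p1).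
have K0 : 0 <= 2 * 4 `^ (p - 1) :> R by rewrite mulr_ge0 ?powR_ge0.
have base (y : R) : `|y| <= 2 * l -> `|y| `^ p <= (2 * l) `^ p.
  by move=> yl; apply: ge0_ler_powR => //; rewrite nnegrE mulr_ge0// ltW.
elim: n => [|n IHn] xl.
  rewrite /dyadic_sum big_ord0 mulr0 addr0 base// (le_trans xl)// expr0 mulr1.
  by rewrite mulr2n mulrDl mul1r lerDl ltW.
have [xn|xn] := leP `|x| (l * 2 ^+ n).
  apply: (le_trans (IHn xn)); rewrite lerD2l ler_wpM2l// /dyadic_sum big_ord_recr/=.
  by rewrite lerDl mulr_ge0 ?powR_ge0 ?excess_ge0.
case: n IHn xl xn => [_ xl _|n _ xl xn].
  rewrite (le_trans (base x _)) ?lerDl//; last by rewrite mulr_ge0// dyadic_sum_ge0.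
  by rewrite mulrC -[X in l * X]expr1.
set y := l * 2 ^+ n; have y0 : 0 < y by rewrite mulr_gt0// exprn_gt0.
have xy4 : `|x| <= 4 * y by move: xl; rewrite /y !exprS; lra.
have xy2 : 2 * y <= `|x| by move: xn; rewrite /y !exprS; lra.
have -> : `|x| `^ p = `|x| * `|x| `^ (p - 1) by rewrite mulr_powRB1// (lt_le_trans _ p1).
have step : `|x| * `|x| `^ (p - 1) <= 2 * excess y x * (4 * y) `^ (p - 1).
  rewrite ler_pM ?powR_ge0//.
    by have : `|x| - y <= excess y x; [rewrite le_max lexx|lra].
  by apply: ge0_ler_powR; rewrite ?nnegrE ?subr_ge0// mulr_ge0// ltW.
apply: (le_trans step); rewrite powRM ?(ltW y0)//.
rewrite (le_trans _ (_ : 2 * 4 `^ (p - 1) * dyadic_sum p l n.+2 x <= _)) ?lerDr ?powR_ge0//.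
rewrite mulrACA -!mulrA; apply: ler_wpM2l => //; apply: ler_wpM2l; first exact: powR_ge0.
rewrite /dyadic_sum 2!big_ord_recr/= -/y [excess _ _ * _]mulrC.
rewrite addrAC lerDr addr_ge0 ?dyadic_sum_ge0//.
by rewrite mulr_ge0 ?powR_ge0 ?excess_ge0.
Qed.

(** Only the nodes below |x| contribute, and their weights form a geometric
    progression of ratio 2^(p-1) > 1, so the largest weight dominates. *)
Lemma dyadic_sum_upper p l n x : 1 < p -> 0 < l ->
  dyadic_sum p l n x <= 2 `^ (p - 1) / (2 `^ (p - 1) - 1) * `|x| `^ p.
Proof.
move=> p1 l0; set r := 2 `^ (p - 1).
have r1 : 1 < r.
  have := @gt0_ltr_powR R (p - 1); rewrite subr_gt0 => /(_ p1 1 2).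
  by rewrite !nnegrE powR1; apply; lra.
have r10 : 0 < r - 1 by rewrite subr_gt0.
pose a k := (l * 2 ^+ k) `^ (p - 1).
have aS k : a k.+1 = r * a k.
  by rewrite /a exprS mulrCA (powRM _ _ (mulr_ge0 (ltW l0) (exprn_ge0 _ _))).
have geom k : \sum_(i < k) a i <= a k / (r - 1).
  elim: k => [|k IHk]; first by rewrite big_ord0 divr_ge0 ?powR_ge0// ltW.
  rewrite big_ord_recr/= aS (le_trans (lerD IHk (lexx _)))//.
  by rewrite le_eqVlt; apply/orP; left; apply/eqP; field; rewrite gt_eqF.
elim: n => [|n IHn].
  by rewrite /dyadic_sum big_ord0 mulr_ge0 ?powR_ge0// divr_ge0 ?powR_ge0// ltW.
have [xn|/ltW xn] := leP `|x| (l * 2 ^+ n).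
  rewrite /dyadic_sum big_ord_recr/= -/(dyadic_sum _ _ _ _).
  have -> : excess (l * 2 ^+ n) x = 0 by apply/max_idPr; rewrite subr_le0.
  by rewrite mulr0 addr0.
have -> : `|x| `^ p = `|x| * `|x| `^ (p - 1) by rewrite mulr_powRB1// (lt_trans _ p1).
have l2 k : 0 <= l * 2 ^+ k by rewrite mulr_ge0 ?exprn_ge0// ltW.
apply: (@le_trans _ _ ((a n.+1 / (r - 1)) * `|x|)).
  apply: le_trans (ler_wpM2r (normr_ge0 x) (geom n.+1)).
  rewrite mulr_suml; apply: ler_sum => k _.
  by rewrite ler_wpM2l ?powR_ge0 ?excess_le.
rewrite aS [leRHS]mulrCA [leLHS]mulrC ler_wpM2l// mulrAC ler_wpM2l//.
  by rewrite divr_ge0 ?powR_ge0// ltW.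
by apply: ge0_ler_powR; rewrite ?nnegrE// subr_ge0 ltW.
Qed.

Lemma powR_normD_le (p a b : R) : 0 <= p ->
  `|a + b| `^ p <= 2 `^ p * (`|a| `^ p + `|b| `^ p).
Proof.
move=> p0; pose M := Num.max `|a| `|b|.
have M0 : 0 <= M by rewrite le_max normr_ge0.
apply: (@le_trans _ _ ((2 * M) `^ p)).
  apply: ge0_ler_powR; rewrite ?nnegrE ?mulr_ge0//.
  apply: le_trans (ler_normD _ _) _.
  have : `|a| <= M by rewrite le_max lexx.
  have : `|b| <= M by rewrite le_max lexx orbT.
  by lra.
rewrite powRM// ler_wpM2l ?powR_ge0// /M.
by case: (leP `|a| `|b|) => _; rewrite ?lerDl ?lerDr powR_ge0.
Qed.

End dyadic.

(** * Integrals of vector-valued functions and truncation *)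

Section vector_integral.
Context {R : realType} {d m : nat}.
Context (mu : 'I_m -> {finite_measure set (borelRd R d) -> \bar R}).
Implicit Types (F G : 'rV[R]_d -> 'I_m -> R).

Definition vintegrable F := forall i,
  (mu i).-integrable [set: borelRd R d] (EFin \o (F ^~ i)).

(** The integral of [F] over the disjoint union of the spaces carrying the
    measures [mu i], seen as one measure space. *)
Definition vintegral F : R := \sum_i \int[mu i]_x F x i.

Lemma vintegralD F G : vintegrable F -> vintegrable G ->
  vintegral (fun x i => F x i + G x i) = vintegral F + vintegral G.
Proof.
move=> iF iG; rewrite /vintegral -big_split/=; apply: eq_bigr => i _.
by rewrite RintegralD //; [exact: iF|exact: iG].
Qed.

Lemma vintegralZ a F : vintegrable F ->
  vintegral (fun x i => a * F x i) = a * vintegral F.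
Proof.
move=> iF; rewrite /vintegral mulr_sumr; apply: eq_bigr => i _.
by rewrite RintegralZl //; exact: iF.
Qed.

Lemma vintegrableD F G : vintegrable F -> vintegrable G ->
  vintegrable (fun x i => F x i + G x i).
Proof. by move=> iF iG i; exact: (integrableD measurableT (iF i) (iG i)). Qed.

Lemma vintegrableZ a F : vintegrable F -> vintegrable (fun x i => a * F x i).
Proof. by move=> iF i; exact: (integrableZl measurableT a (iF i)). Qed.

Lemma vintegrable_cst a : vintegrable (fun _ _ => a).
Proof. by move=> i; exact: finite_measure_integrable_cst. Qed.

Lemma vintegral_cst a : vintegral (fun _ _ => a) = a * vintegral (fun _ _ => 1).
Proof.
rewrite -vintegralZ; last exact: vintegrable_cst.
by apply: eq_bigr => i _; apply: eq_Rintegral => x _; rewrite mulr1.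
Qed.

Lemma vintegrable_sum n (F : 'I_n -> 'rV[R]_d -> 'I_m -> R) :
  (forall k, vintegrable (F k)) -> vintegrable (fun x i => \sum_k F k x i).
Proof.
elim: n F => [|n IHn] F iF.
  have -> : (fun x i => \sum_k F k x i) = (fun _ _ => 0); last exact: vintegrable_cst.
  by apply/funext => x; apply/funext => i; rewrite big_ord0.
have -> : (fun x i => \sum_k F k x i) =
    (fun x i => \sum_k F (widen_ord (leqnSn n) k) x i + F ord_max x i).
  by apply/funext => x; apply/funext => i; rewrite big_ord_recr.
by apply: vintegrableD => //; exact: IHn.
Qed.

Lemma vintegral_sum n (F : 'I_n -> 'rV[R]_d -> 'I_m -> R) :
  (forall k, vintegrable (F k)) ->
  vintegral (fun x i => \sum_k F k x i) = \sum_k vintegral (F k).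
Proof.
elim: n F => [|n IHn] F iF.
  rewrite big_ord0 -[RHS](mul0r (vintegral (fun _ _ => 1))) -vintegral_cst.
  by congr vintegral; apply/funext => x; apply/funext => i; rewrite big_ord0.
have -> : (fun x i => \sum_k F k x i) =
    (fun x i => \sum_k F (widen_ord (leqnSn n) k) x i + F ord_max x i).
  by apply/funext => x; apply/funext => i; rewrite big_ord_recr.
by rewrite vintegralD ?IHn ?big_ord_recr//; exact: vintegrable_sum.
Qed.

Lemma le_vintegral F G : vintegrable F -> vintegrable G ->
  (forall x i, F x i <= G x i) -> vintegral F <= vintegral G.
Proof.
by move=> iF iG FG; apply: ler_sum => i _; apply: le_Rintegral => [//||| x _ //];
  [exact: iF|exact: iG].
Qed.

Lemma vintegral_ge0 F : (forall x i, 0 <= F x i) -> 0 <= vintegral F.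
Proof. by move=> F0; apply: sumr_ge0 => i _; apply: Rintegral_ge0 => x _. Qed.

Lemma ler_norm_coord (v : 'rV[R]_m) i : `|v ord0 i| <= `|v|.
Proof.
rewrite [leRHS]/Num.norm/= mx_normrE.
by apply: (le_bigmax _ (fun ij => `|v ij.1 ij.2|) (ord0, i)).
Qed.

Lemma row_norm_le (v : 'rV[R]_m) a : 0 <= a -> (forall i, `|v ord0 i| <= a) -> `|v| <= a.
Proof.
move=> a0 va; rewrite [leLHS]/Num.norm/= mx_normrE.
by apply: bigmax_le => //= -[i j] _; rewrite ord1.
Qed.

Lemma Cb_coord_le (f : Cb R d m) x i : `|f x ord0 i| <= `|f|.
Proof. by apply: le_trans (ler_norm_coord _ _) _; exact: ler_Cb_norm. Qed.

Lemma Cb_norm_le_coord (f : Cb R d m) a : 0 <= a ->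
  (forall x i, `|f x ord0 i| <= a) -> `|f| <= a.
Proof. by move=> a0 fa; apply: Cb_norm_le => x; exact: row_norm_le. Qed.

(** The measures are finite, and the values of [f] stay in a bounded set on which
    [phi] is bounded. *)
Lemma vintegrable_comp (phi : R -> R) (f : Cb R d m) :
  measurable_fun [set: R] phi ->
  (forall M, exists B, forall u, `|u| <= M -> `|phi u| <= B) ->
  vintegrable (fun x i => phi (f x ord0 i)).
Proof.
move=> mphi bphi i; apply: measurable_bounded_integrable => //.
- by rewrite -ge0_fin_numE// fin_num_measure.
- by apply: (measurableT_comp mphi); exact: Cb_measurable.
- have [B fB] := bphi `|f|; exists B; split; first exact: num_real.
  move=> M /ltW BM x _ /=; apply: le_trans BM; apply: fB.
  exact: Cb_coord_le.
Qed.

Lemma vintegrable_norm (f : Cb R d m) : vintegrable (fun x i => `|f x ord0 i|).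
Proof.
apply: vintegrable_comp => [|M]; first exact: normr_measurable.
by exists M => u; rewrite normr_id.
Qed.

Lemma vintegrable_excess (f : Cb R d m) (l : R) : 0 <= l ->
  vintegrable (fun x i => excess l (f x ord0 i)).
Proof.
move=> l0; apply: vintegrable_comp => [|M].
  have := @measurable_maxr _ R R setT (fun u => `|u| - l) (cst 0).
  apply => //.
  by apply: measurable_funB => //; exact: normr_measurable.
exists M => u uM; rewrite ger0_norm ?excess_ge0//.
exact: (le_trans (excess_le _ _ l0)).
Qed.

Lemma vintegrable_powR (f : Cb R d m) p : 0 <= p ->
  vintegrable (fun x i => `|f x ord0 i| `^ p).
Proof.
move=> p0; apply: (@vintegrable_comp (fun u => `|u| `^ p)) => [|M].
  exact: (measurableT_comp (measurable_powR p) (@normr_measurable R setT)).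
exists (M `^ p) => u uM; rewrite ger0_norm ?powR_ge0//.
by apply: ge0_ler_powR => //; rewrite nnegrE// (le_trans _ uM).
Qed.

End vector_integral.

Section Cb_coordinates.
Context {R : realType} {d m : nat}.

Lemma Cb_of_coord (g : 'I_m -> 'rV[R]_d -> R) :
  (forall i, continuous (g i)) -> (exists M, forall i x, `|g i x| <= M) ->
  {f : Cb R d m | forall x i, f x ord0 i = g i x}.
Proof.
move=> gc gb; suff h : (fun x => \row_i g i x) \in @Cb_pred R d m.
  by exists (MkCb h) => x i; rewrite mxE.
apply/asboolP; split.
  move=> x; pose nF := @nbhs_filter _ x.
  apply/(@cvg_ballP R 'rV[R]_m 'rV[R]_d (nbhs x) nF) => e e0.
  have H i : \forall y \near x, ball (g i x) e (g i y).
    exact: ((@cvg_ballP R R _ _ nF _ _).1 (gc i x)).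
  have : \forall y \near x, forall i, ball (g i x) e (g i y).
    exact: (@filter_forall _ _ _ (nbhs x) nF H).
  by apply: (@filterS _ _ nF) => y H'; split=> // i j; rewrite !mxE.
have [M gM] := gb; exists `|M| => x; apply: row_norm_le => // i.
by rewrite mxE (le_trans (gM _ _))// ler_norm.
Qed.

Definition clamp (l u : R) := Num.max (- l) (Num.min l u).

Lemma clamp_norm l u : 0 <= l -> `|clamp l u| <= l.
Proof.
move=> l0; rewrite ler_norml le_max lexx/= ge_max ge_min lexx andbT.
by rewrite (le_trans _ l0)// oppr_le0.
Qed.

Lemma clamp_id l u : `|u| <= l -> clamp l u = u.
Proof.
rewrite ler_norml => /andP[lu ul]; rewrite /clamp (min_idPr ul).
exact/max_idPr.
Qed.

Lemma clamp_excess l u : 0 <= l -> `|u - clamp l u| = excess l u.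
Proof.
move=> l0; have [ul|ul] := leP `|u| l.
  by rewrite clamp_id// subrr normr0; apply/esym/max_idPr; rewrite subr_le0.
have -> : excess l u = `|u| - l by apply/max_idPl; rewrite subr_ge0 ltW.
rewrite /clamp; have [u0|u0] := ler0P u; move: ul.
  rewrite ler0_norm// => ul; rewrite (min_idPr _); last by lra.
  by rewrite (max_idPl _) ?ler0_norm; lra.
rewrite gtr0_norm// => ul; rewrite (min_idPl _); last by lra.
by rewrite (max_idPr _) ?ger0_norm; lra.
Qed.

Lemma clamp_lipschitz (l u v : R) : 0 <= l -> `|clamp l u - clamp l v| <= `|u - v|.
Proof.
move=> l0; have h := ler_norm (u - v); have := lerNnormlW (lexx `|u - v|) => h'.
have maxE (a b : R) : Num.max a b = if a < b then b else a by [].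
have minE (a b : R) : Num.min a b = if a < b then a else b by [].
rewrite ler_norml /clamp !maxE !minE; apply/andP.
by case: (ltP l u) => ?; case: (ltP l v) => ?;
  case: (ltP (- l) l) => ?; case: (ltP (- l) u) => ?; case: (ltP (- l) v) => ?;
  split; lra.
Qed.

Lemma clamp_continuous l : continuous (clamp l).
Proof.
move=> u; apply: (@continuous_max _ _ (cst (- l)) (fun u => Num.min l u)).
  exact: cst_continuous.
apply: (@continuous_min _ _ (cst l) id); first exact: cst_continuous.
by move=> ?.
Qed.

Lemma Cb_clamp_ex l (f : Cb R d m) :
  {g : Cb R d m | forall x i, g x ord0 i = clamp l (f x ord0 i)}.
Proof.
apply: Cb_of_coord => [i x|].
  apply: (@continuous_comp _ _ _ (fun x => f x ord0 i)); last exact: clamp_continuous.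
  apply: (@continuous_comp _ _ _ f (fun y : 'rV[R]_m => y ord0 i)).
    exact: Cb_continuous.
  exact: coord_continuous.
exists `|l| => i x; have [l0|l0] := leP 0 l.
  by rewrite (ger0_norm l0); exact: clamp_norm.
rewrite /clamp; have -> : Num.max (- l) (Num.min l (f x ord0 i)) = - l.
  by apply/max_idPl; rewrite ge_min; apply/orP; left; lra.
by rewrite normrN.
Qed.

Definition Cb_clamp l (f : Cb R d m) : Cb R d m := projT1 (Cb_clamp_ex l f).

Lemma Cb_clampE l (f : Cb R d m) x i : Cb_clamp l f x ord0 i = clamp l (f x ord0 i).
Proof. exact: (projT2 (Cb_clamp_ex l f)). Qed.

Lemma Cb_clamp_norm l (f : Cb R d m) : 0 <= l -> `|Cb_clamp l f| <= l.
Proof.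
by move=> l0; apply: Cb_norm_le_coord => // x i; rewrite Cb_clampE clamp_norm.
Qed.

Lemma CbBE (f g : Cb R d m) x i : (f - g) x ord0 i = f x ord0 i - g x ord0 i.
Proof. by rewrite !mxE. Qed.

Lemma CbZE a (f : Cb R d m) x i : (a *: f) x ord0 i = a * f x ord0 i.
Proof. by rewrite mxE. Qed.

Lemma Cb_clampB l (f : Cb R d m) x i : 0 <= l ->
  `|(f - Cb_clamp l f) x ord0 i| = excess l (f x ord0 i).
Proof. by move=> l0; rewrite CbBE Cb_clampE clamp_excess. Qed.

End Cb_coordinates.

(** * Compact interpolation *)

Section L1norm.
Context {R : realType} {d m : nat}.
Context (mu : 'I_m -> {finite_measure set (borelRd R d) -> \bar R}).
Implicit Types (f g : Cb R d m).

Definition L1norm f := vintegral mu (fun x i => `|f x ord0 i|).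

(** Vanishing of [excess_mass l f] encodes the bound |f| <= l almost everywhere,
    while staying an integral to which the triangle inequality applies. *)
Definition excess_mass (l : R) f := vintegral mu (fun x i => excess l (f x ord0 i)).

Lemma L1norm_ge0 f : 0 <= L1norm f.
Proof. exact: vintegral_ge0. Qed.

Lemma excess_mass_ge0 l f : 0 <= excess_mass l f.
Proof. by apply: vintegral_ge0 => x i; exact: excess_ge0. Qed.

Lemma L1normB f g : L1norm f <= L1norm g + L1norm (f - g).
Proof.
rewrite -vintegralD; [|exact: vintegrable_norm..].
apply: le_vintegral => [||x i]; first exact: vintegrable_norm.
  by apply: vintegrableD; exact: vintegrable_norm.
by rewrite CbBE; have := ler_normD (g x ord0 i) (f x ord0 i - g x ord0 i); rewrite subrKC.
Qed.

Lemma excess_massB l f g : 0 <= l ->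
  excess_mass l f <= excess_mass l g + L1norm (f - g).
Proof.
move=> l0; rewrite -vintegralD; [|exact: vintegrable_excess|exact: vintegrable_norm].
apply: le_vintegral => [||x i]; first exact: vintegrable_excess.
  by apply: vintegrableD; [exact: vintegrable_excess|exact: vintegrable_norm].
by rewrite CbBE; have := excessD l (g x ord0 i) (f x ord0 i - g x ord0 i); rewrite subrKC.
Qed.

Lemma L1norm_le f : L1norm f <= `|f| * vintegral mu (fun _ _ => 1).
Proof.
rewrite -vintegral_cst; apply: le_vintegral => [||x i].
- exact: vintegrable_norm.
- exact: vintegrable_cst.
- exact: Cb_coord_le.
Qed.

End L1norm.

Section compact_interpolation.
Context {R : realType} {d m : nat}.
Context (nu mu : 'I_m -> {finite_measure set (borelRd R d) -> \bar R}).
Context (T : Cb R d m -> Cb R d m) (C : R).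
Hypothesis T_L1 : forall f, L1norm mu (T f) <= C * L1norm nu f.
Hypothesis T_linear : forall a f g,
  L1norm mu (T (a *: f + g) - (a *: T f + T g)) = 0.
Hypothesis C_ge0 : 0 <= C.
Hypothesis T_compact : compact_operator T.

(** The truncated part of [f] is mapped below the level [w * l], so only the image
    of [f - clamp l f] can exceed it, and this remainder has L1 norm equal to the
    excess of [f] over [l]. *)
Lemma excess_mass_truncation (w l : R) f : 0 <= w -> 0 <= l ->
  excess_mass mu (w * l) (T (Cb_clamp l f)) = 0 ->
  excess_mass mu (w * l) (T f) <= C * excess_mass nu l f.
Proof.
move=> w0 l0 ex0; set g := Cb_clamp l f.
have := excess_massB mu _ (T f) (T g) (mulr_ge0 w0 l0); rewrite ex0 add0r.
move=> /le_trans; apply.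
have := T_linear 1 g (f - g); rewrite !scale1r subrKC => lin.
have := L1normB mu (T f - T g) (T (f - g)).
rewrite -addrA -opprD lin addr0 => /le_trans; apply.
apply: le_trans (T_L1 _) _; rewrite ler_wpM2l//.
apply: le_vintegral => [||x i]; [exact: vintegrable_norm|exact: vintegrable_excess|].
by rewrite Cb_clampB.
Qed.

Lemma excess_mass_scale (w l : R) f : 0 <= w -> 0 <= l ->
  excess_mass mu w (T f) = 0 -> excess_mass mu (w * l) (T (l *: f)) = 0.
Proof.
move=> w0 l0 ex0.
have T0 : L1norm mu (T 0) = 0.
  apply/eqP; rewrite eq_le L1norm_ge0 andbT; apply: le_trans (T_L1 0) _.
  rewrite -[leRHS](mulr0 C); apply: ler_wpM2l => //.
  by apply: le_trans (L1norm_le _ _) _; rewrite normr0 mul0r.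
apply/eqP; rewrite eq_le excess_mass_ge0 andbT.
apply: le_trans (excess_massB _ _ _ (l *: T f) (mulr_ge0 w0 l0)) _.
have -> : excess_mass mu (w * l) (l *: T f) = 0.
  rewrite -(mulr0 l) -ex0 -vintegralZ; last exact: vintegrable_excess.
  congr vintegral; apply/funext => x; apply/funext => i.
  by rewrite CbZE mulrC excessM.
rewrite add0r; apply: le_trans (L1normB _ _ (T 0)) _; rewrite T0 add0r.
by have := T_linear l f 0; rewrite addr0 opprD addrA => ->.
Qed.

Definition interpolation_const (p : R) :=
  2 * 4 `^ (p - 1) * (2 `^ (p - 1) / (2 `^ (p - 1) - 1)).

Lemma interpolation_const_ge0 p : 1 < p -> 0 <= interpolation_const p.
Proof.
move=> p1; have := @gt0_ltr_powR R (p - 1); rewrite subr_gt0 => /(_ p1 1 2).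
rewrite !nnegrE powR1 => r1; rewrite /interpolation_const.
by rewrite !mulr_ge0 ?powR_ge0// invr_ge0 subr_ge0 ltW// r1//; lra.
Qed.

Lemma pow2_archi (x : R) : exists n, x <= 2 ^+ n.
Proof.
exists (Num.bound `|x|); rewrite (le_trans (ler_norm x))//.
apply: le_trans (ltW (archi_boundP (normr_ge0 _))) _.
by rewrite -natrX ler_nat; apply: ltnW; exact: ltn_expl.
Qed.

(** Replace each power by its dyadic sum and compare the excesses node by node:
    the node [l * 2 ^+ k] for [f] corresponds to [w * l * 2 ^+ k] for [T f], and
    the ratio of the weights produces the factor [w `^ (p - 1)]. *)
Lemma truncated_interpolation (p w : R) f : 1 < p -> 0 < w ->
  (forall l, 0 < l -> excess_mass mu (w * l) (T (Cb_clamp l f)) = 0) ->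
  vintegral mu (fun x i => `|T f x ord0 i| `^ p) <=
  interpolation_const p * w `^ (p - 1) * C *
    vintegral nu (fun x i => `|f x ord0 i| `^ p).
Proof.
move=> p1 w0 exT; set Y := leRHS.
have p0 : 0 < p by rewrite (lt_trans _ p1).
have step l : 0 < l -> vintegral mu (fun x i => `|T f x ord0 i| `^ p) <=
    (2 * (w * l)) `^ p * vintegral mu (fun _ _ => 1) + Y.
  move=> l0; have wl0 : 0 < w * l by rewrite mulr_gt0.
  have l2 k : 0 <= l * 2 ^+ k by rewrite mulr_ge0 ?exprn_ge0// ltW.
  have wl2 k : 0 <= w * l * 2 ^+ k by rewrite mulr_ge0 ?exprn_ge0// ltW.
  have [n Tn] := pow2_archi (`|T f| / (w * l)).
  rewrite ler_pdivrMr// [_ * (w * l)]mulrC in Tn.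
  have ds (la : 'I_m -> {finite_measure set (borelRd R d) -> \bar R})
      (g : Cb R d m) (c : R) :
      0 < c -> vintegrable la (fun x i => dyadic_sum p c n (g x ord0 i)).
    move=> c0; apply: (@vintegrable_sum _ _ _ la n (fun k x i =>
      (c * 2 ^+ k) `^ (p - 1) * excess (c * 2 ^+ k) (g x ord0 i))) => k.
    apply: (@vintegrableZ _ _ _ la _ (fun x i => excess (c * 2 ^+ k) (g x ord0 i))).
    by apply: vintegrable_excess; rewrite mulr_ge0 ?exprn_ge0// ltW.
  apply: (@le_trans _ _ (vintegral mu (fun x i => (2 * (w * l)) `^ p +
      2 * 4 `^ (p - 1) * dyadic_sum p (w * l) n (T f x ord0 i)))).
    apply: le_vintegral => [||x i].
    - exact: vintegrable_powR (ltW p0).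
    - by apply: vintegrableD; [exact: vintegrable_cst|exact/vintegrableZ/ds].
    - apply: dyadic_sum_lower => //; first exact: ltW.
      exact: le_trans (Cb_coord_le _ _ _) _.
  rewrite vintegralD; [|exact: vintegrable_cst|exact/vintegrableZ/ds].
  rewrite vintegral_cst lerD2l vintegralZ; last exact: ds.
  rewrite /Y /interpolation_const -!mulrA; apply: ler_wpM2l => //.
  apply: ler_wpM2l; first exact: powR_ge0.
  apply: (@le_trans _ _ (w `^ (p - 1) * (C *
      vintegral nu (fun x i => dyadic_sum p l n (f x ord0 i))))).
    rewrite vintegral_sum; last first.
      by move=> k; apply/vintegrableZ/vintegrable_excess.
    rewrite vintegral_sum; last first.
      by move=> k; apply/vintegrableZ/vintegrable_excess.
    rewrite 2!mulr_sumr; apply: ler_sum => k _.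
    rewrite 2?vintegralZ; [|exact: vintegrable_excess..].
    rewrite -mulrA powRM ?(ltW w0)// -mulrA; apply: ler_wpM2l; first exact: powR_ge0.
    rewrite [leRHS]mulrCA; apply: ler_wpM2l; first exact: powR_ge0.
    apply: excess_mass_truncation => //; first exact: ltW.
    by apply: exT; rewrite mulr_gt0// exprn_gt0.
  have upper : vintegral nu (fun x i => dyadic_sum p l n (f x ord0 i)) <=
      2 `^ (p - 1) / (2 `^ (p - 1) - 1) *
      vintegral nu (fun x i => `|f x ord0 i| `^ p).
    rewrite -vintegralZ; last exact: vintegrable_powR (ltW p0).
    apply: le_vintegral => [||x i]; first exact: ds.
      by apply: vintegrableZ; exact: vintegrable_powR (ltW p0).
    exact: dyadic_sum_upper.
  apply: le_trans (ler_wpM2l (powR_ge0 _ _) (ler_wpM2l C_ge0 upper)) _.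
  by rewrite le_eqVlt; apply/orP; left; apply/eqP; ring.
apply/ler_addgt0Pr => e e0; rewrite addrC.
set M := vintegral mu (fun _ _ => 1) in step.
have M0 : 0 <= M by apply: vintegral_ge0.
have M1 : 0 < M + 1 by rewrite ltr_wpDl.
(* This first node makes the additive error of the lower bound at most e. *)
pose l := (e / (M + 1)) `^ p^-1 / (2 * w).
have l0 : 0 < l by rewrite divr_gt0 ?powR_gt0 ?divr_gt0// mulr_gt0.
apply: le_trans (step l l0) _; rewrite lerD2r.
have -> : 2 * (w * l) = (e / (M + 1)) `^ p^-1 by rewrite /l; field; rewrite gt_eqF.
rewrite -powRrM mulVf ?gt_eqF// powRr1 ?divr_ge0 ?(ltW e0) ?(ltW M1)//.
by rewrite mulrAC ler_pdivrMr// ler_wpM2l ?(ltW e0)// lerDl.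
Qed.

Lemma compact_bounded_image (A : set (Cb R d m)) (M : R) :
  (forall f, A f -> `|f| <= M) -> compact (closure (T @` A)).
Proof.
move=> AM; rewrite -precompactE; apply: T_compact.
exists M; split; first exact: num_real.
by move=> x /ltW Mx f Af /=; exact: le_trans (AM f Af) Mx.
Qed.

(** Otherwise there are phi_n of sup norm at most 1 with L1 norm tending to 0 and
    T phi_n exceeding w.  By compactness T phi_n has a cluster point g in the sup
    norm; continuity of T in L1 forces g = 0 almost everywhere, and some T phi_n
    is within w of g everywhere. *)
Lemma excess_mass_small (w : R) : 0 < w -> exists2 delta : R, 0 < delta &
  forall f, `|f| <= 1 -> L1norm nu f <= delta -> excess_mass mu w (T f) = 0.
Proof.
move=> w0; apply: contrapT => /forall2NP H.
have : forall n : nat, exists f : Cb R d m,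
    [/\ `|f| <= 1, L1norm nu f <= n.+1%:R^-1 & excess_mass mu w (T f) != 0].
  move=> n; case: (H n.+1%:R^-1) => [[]|]; first by rewrite invr_gt0 ltr0Sn.
  move=> /existsNP[f /not_implyP[f1 /not_implyP[fn /eqP fw]]].
  by exists f.
move=> /choice[phi phiP].
pose A := [set f : Cb R d m | `|f| <= 1].
have cptA : compact (closure (T @` A)) by exact: (@compact_bounded_image _ 1).
have [g [_ clg]] : closure (T @` A) `&` cluster ((T \o phi) @ \oo) !=set0.
  apply: cptA; exists 0%N => // n _ /=; apply: subset_closure.
  by exists (phi n) => //; have [] := phiP n.
have near_g (e : R) (N : nat) : 0 < e ->
    exists2 n, (N <= n)%N & `|T (phi n) - g| < e.
  move=> e0; have := clg [set T (phi n) | n in [set n | (N <= n)%N]] (ball g e).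
  move=> /(_ _ (nbhsx_ballx _ _ e0))[].
    by exists N => // n Nn /=; exists n.
  move=> _ [[n Nn <-]]; rewrite -ball_normE/= distrC => ?.
  by exists n.
pose M := vintegral mu (fun _ _ => 1).
have M0 : 0 <= M by exact: vintegral_ge0.
have g0 : L1norm mu g = 0.
  apply/eqP; rewrite eq_le L1norm_ge0 andbT; apply/ler_addgt0Pr => e e0; rewrite add0r.
  pose e' := e / 2 / (M + 1).
  have M1 : 0 < M + 1 by rewrite ltr_wpDl.
  have e'0 : 0 < e' by rewrite !divr_gt0.
  have [N CN] : exists N : nat, C * N.+1%:R^-1 <= e / 2.
    exists (Num.bound (C / (e / 2))); rewrite ler_pdivrMr// mulrC -ler_pdivrMr ?divr_gt0//.
    apply: ltW; apply: lt_trans (archi_boundP _) _; rewrite ?ltr_nat//.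
    by rewrite divr_ge0// ltW// divr_gt0.
  have [n Nn gn] := near_g _ N e'0.
  apply: le_trans (L1normB mu g (T (phi n))) _.
  have -> : e = e / 2 + e / 2 by rewrite -splitr.
  apply: lerD.
    have [_ phin _] := phiP n.
    apply: le_trans (T_L1 _) _; apply: le_trans CN; apply: ler_wpM2l => //.
    by apply: le_trans phin _; rewrite lef_pV2 ?posrE ?ltr0Sn// ler_nat ltnS.
  apply: le_trans (L1norm_le _ _) _; rewrite -/M distrC.
  apply: (@le_trans _ _ (e' * M)); first by rewrite ler_wpM2r// ltW.
  by rewrite /e' mulrAC ler_pdivrMr// ler_wpM2l ?lerDl// ltW// divr_gt0.
have [n _ gn] := near_g w 0%N w0.
have [_ _ /eqP[]] := phiP n.
apply/eqP; rewrite eq_le excess_mass_ge0 andbT -g0.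
apply: le_vintegral => [||x i].
- by apply: vintegrable_excess; exact: ltW.
- exact: vintegrable_norm.
- rewrite ge_max normr_ge0 andbT lerBlDr.
  have := ler_normD (g x ord0 i) (T (phi n) x ord0 i - g x ord0 i).
  rewrite subrKC => /le_trans; apply; rewrite lerD2l -CbBE.
  by apply: le_trans (Cb_coord_le _ _ _) (ltW gn).
Qed.

(** The normalised truncations of the tail are bounded by 1 and live where
    |f| > K, hence by Chebyshev's inequality have L1 norm at most M / K^p.  For K
    large, T maps them below w, and interpolation bounds the image of the whole
    tail by a multiple of w^(p-1). *)
Lemma compact_tail (p M eta : R) : 1 < p -> 0 <= M -> 0 < eta ->
  exists2 K : R, 0 < K & forall f : Cb R d m,
    vintegral nu (fun x i => `|f x ord0 i| `^ p) <= M ->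
    vintegral mu (fun x i => `|T (f - Cb_clamp K f) x ord0 i| `^ p) <= eta.
Proof.
move=> p1 M0 eta0; have p0 : 0 < p by rewrite (lt_trans _ p1).
pose B := interpolation_const p * C * M.
have I0 := interpolation_const_ge0 _ p1.
have B0 : 0 <= B by apply: mulr_ge0 => //; exact: mulr_ge0.
have B1 : 0 < B + 1 by rewrite ltr_wpDl.
(* Solves B w^(p-1) <= eta, where B collects the interpolation constants. *)
pose w := (eta / (B + 1)) `^ (p - 1)^-1.
have w0 : 0 < w by apply: powR_gt0; rewrite divr_gt0.
have wE : w `^ (p - 1) = eta / (B + 1).
  rewrite -powRrM mulVf ?gt_eqF ?subr_gt0// powRr1//.
  by rewrite divr_ge0 ?(ltW eta0) ?(ltW B1).
have [delta delta0 small] := excess_mass_small w w0.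
have M1 : 0 < M + 1 by rewrite ltr_wpDl.
(* Solves M / K^p <= delta, the Chebyshev bound for the set where |f| > K. *)
pose K := ((M + 1) / delta) `^ p^-1.
have K0 : 0 < K by apply: powR_gt0; rewrite divr_gt0.
have KE : K `^ p = (M + 1) / delta.
  rewrite -powRrM mulVf ?gt_eqF// powRr1//.
  by rewrite divr_ge0 ?(ltW delta0) ?(ltW M1).
exists K => // f fM; set g := f - Cb_clamp K f.
have gE x i : `|g x ord0 i| = excess K (f x ord0 i) by rewrite Cb_clampB// ltW.
have gf : vintegral nu (fun x i => `|g x ord0 i| `^ p) <= M.
  apply: le_trans fM; apply: le_vintegral => [||x i].
  - exact: vintegrable_powR (ltW p0).
  - exact: vintegrable_powR (ltW p0).
  - rewrite gE; apply: ge0_ler_powR; rewrite ?nnegrE ?excess_ge0 ?(ltW p0)//.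
    by apply: excess_le; exact: ltW.
apply: le_trans (truncated_interpolation p w g p1 w0 _) _; last first.
  rewrite wE; set k := interpolation_const p.
  have h : 0 <= k * (eta / (B + 1)) * C.
    apply: mulr_ge0 => //; apply: mulr_ge0 => //.
    by rewrite divr_ge0 ?(ltW eta0) ?(ltW B1).
  apply: le_trans (ler_wpM2l h gf) _.
  rewrite [leLHS](_ : _ = eta * B / (B + 1)); last by rewrite /B -/k; ring.
  by rewrite ler_pdivrMr// ler_wpM2l ?(ltW eta0)// lerDl.
move=> l l0; set h := l^-1 *: Cb_clamp l g.
have -> : Cb_clamp l g = l *: h by rewrite scalerA mulfV ?gt_eqF// scale1r.
apply: excess_mass_scale; [exact: ltW..|apply: small].
  rewrite normrZ gtr0_norm ?invr_gt0// ler_pdivrMl// mulr1.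
  by rewrite Cb_clamp_norm// ltW.
apply: (@le_trans _ _ (delta / (M + 1) * M)); last first.
  by rewrite mulrAC ler_pdivrMr// ler_wpM2l ?(ltW delta0)// lerDl.
have dM0 : 0 <= delta / (M + 1) by rewrite divr_ge0 ?(ltW delta0) ?(ltW M1).
apply: le_trans (ler_wpM2l dM0 fM).
rewrite -vintegralZ; last exact: vintegrable_powR (ltW p0).
apply: le_vintegral => [||x i].
- exact: vintegrable_norm.
- by apply: vintegrableZ; exact: vintegrable_powR (ltW p0).
- have -> : delta / (M + 1) = (K `^ p)^-1 by rewrite KE invf_div.
  rewrite CbZE Cb_clampE normrM gtr0_norm ?invr_gt0//.
  have [fK|fK] := leP `|f x ord0 i| K.
    have g0 : g x ord0 i = 0.
      apply/eqP; rewrite -normr_eq0 gE; apply/eqP/max_idPr.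
      by rewrite subr_le0.
    rewrite g0 clamp_id ?normr0 ?mulr0 ?(ltW l0)// mulr_ge0 ?powR_ge0//.
    by rewrite invr_ge0 powR_ge0.
  apply: (@le_trans _ _ 1).
    by rewrite ler_pdivrMl// mulr1 clamp_norm// ltW.
  rewrite ler_pdivlMl ?(powR_gt0 p K0)// mulr1.
  by apply: ge0_ler_powR; rewrite ?nnegrE ?(ltW p0) ?(ltW K0) ?(ltW fK).
Qed.

End compact_interpolation.

(** * Precompactness by approximation *)

Section precompactness.
Context {K : realType} {V : normedModType K}.

(** Completeness restricted to geometrically convergent sequences: the centres of
    balls of radius 4^-(n+1) in an ultrafilter form such a sequence, and for Lp spaces
    the rate makes the limit explicit. *)
Definition geometric_complete := forall u : nat -> V,
  (forall n, `|u n.+1 - u n| <= 4 ^- n) -> exists l : V, u @ \oo --> l.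

(** Transport the ultrafilter to the compact set [Q] by replacing points with their
    nearby points of [Q]; a cluster point of the transported filter is the centre
    of a small ball belonging to the ultrafilter. *)
Lemma ultra_small_ball (A : set V) (F : set_system V) (e : K) :
  UltraFilter F -> F (closure A) -> 0 < e ->
  (exists2 Q : set V, compact Q &
    forall a, A a -> exists2 q, Q q & `|a - q| <= e / 4) ->
  exists x : V, F (ball x e).
Proof.
move=> UF FA e0 [Q cQ AQ].
have clAQ a : closure A a -> exists2 q, Q q & `|a - q| <= e / 2.
  move=> /(_ (ball a (e / 4))) [|b [/AQ[q Qq bq]]].
    by apply: nbhsx_ballx; rewrite divr_gt0.
  rewrite -ball_normE/= => ab; exists q => //.
  have := ler_normD (a - b) (b - q); rewrite addrA subrK => /le_trans; apply.
  by apply: le_trans (lerD (ltW ab) bq) _; lra.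
(* The filter F pushed forward along the relation of being within e / 2. *)
pose G := [set S : set V |
  F [set a | forall q, Q q -> `|a - q| <= e / 2 -> S q]].
have FG : Filter G.
  split; rewrite /G/=.
  - by apply: filterS filterT.
  - move=> S S' GS GS'; apply: (@filterS _ F _ _ _ _ (@filterI _ F _ _ _ GS GS')).
    by move=> a [aS aS'] q Qq aq; split; [exact: aS|exact: aS'].
  - by move=> S S' SS' GS; apply: (@filterS _ F _ _ _ _ GS) => a aS q Qq aq; apply/SS'/aS.
have PG : ProperFilter G.
  apply: Build_ProperFilter_ex => S GS.
  by have [a [aS /clAQ[q Qq aq]]] := @filter_ex _ F _ _ (@filterI _ F _ _ _ GS FA); exists q; exact: aS.
have GQ : G Q by apply: (@filterS _ F _ _ _ _ filterT) => a _ q.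
have [x [Qx clx]] := cQ _ PG GQ.
exists x; have [//|Fn] := in_ultra_setVsetC (ball x e) UF.
pose S := [set q | exists2 a, ~ ball x e a & `|a - q| <= e / 2].
have GS : G S by apply: (@filterS _ F _ _ _ _ Fn) => a xa q Qq aq; exists a.
have [|q [[a xa aq] xq]] := clx S (ball x (e / 2)) GS.
  by apply: nbhsx_ballx; rewrite divr_gt0.
case: xa; move: xq; rewrite -!ball_normE/= => xq.
rewrite distrC in aq.
have := ler_normD (x - q) (q - a); rewrite addrA subrK => /le_lt_trans; apply.
by have := ltr_leD xq aq; rewrite -splitr.
Qed.

(** An ultrafilter on the closure of [A] contains balls of radius 4^-(n+1) for all
    n.  Any two of them meet, so their centres converge geometrically, and the
    ultrafilter converges to the same limit. *)
Lemma precompact_approx (A : set V) : geometric_complete ->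
  (forall e : K, 0 < e -> exists2 Q : set V, compact Q &
    forall a, A a -> exists2 q, Q q & `|a - q| <= e) ->
  precompact A.
Proof.
move=> complete AQ; rewrite precompactE compact_ultra => F UF FA.
have /choice[x xP] : forall n, exists x : V, F (ball x (4 ^- n.+1)).
  move=> n.
  have e0 : 0 < 4 ^- n.+1 :> K by rewrite invr_gt0 exprn_gt0.
  by apply: (@ultra_small_ball A) => //; apply: AQ; rewrite divr_gt0.
have [n|l xl] := complete x.
  have [y []] := filter_ex (filterI (xP n.+1) (xP n)).
  rewrite -!ball_normE/= => xy yx.
  have := ler_normD (x n.+1 - y) (y - x n); rewrite addrA subrK => /le_trans; apply.
  rewrite [`|y - _|]distrC; apply: le_trans (lerD (ltW xy) (ltW yx)) _.
  have : 0 < 4 ^- n :> K by rewrite invr_gt0 exprn_gt0.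
  by rewrite !exprS !invfM; lra.
have Fl : F --> l.
  move=> B /nbhs_ballP[e /= e0 eB].
  have e20 : 0 < e / 2 by rewrite divr_gt0.
  have [N _ Nl] : \forall n \near \oo, ball l (e / 2) (x n).
    by apply: xl; exact: nbhsx_ballx.
  have [k ke] : exists k : nat, 4 ^- k.+1 <= e / 2.
    exists (Num.bound (e / 2)^-1).
    rewrite -[leRHS]invrK lef_pV2 ?posrE ?invr_gt0 ?exprn_gt0//.
    apply: le_trans (ltW (archi_boundP _)) _; first by rewrite invr_ge0 ltW.
    rewrite -natrX ler_nat; apply: leq_trans (ltnW (ltn_expl _ (isT : (1 < 4)%N))) _.
    by rewrite leq_exp2l.
  pose n := maxn N k.
  have nk : 4 ^- n.+1 <= 4 ^- k.+1 :> K.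
    rewrite lef_pV2 ?posrE ?exprn_gt0// ler_weXn2l ?ltnS ?leq_maxr//.
    by rewrite ler1n.
  apply: filterS (xP n) => y xy; apply: eB.
  have /= := Nl n (leq_maxl _ _); move: xy; rewrite -!ball_normE/= => xy lx.
  have := ler_normD (l - x n) (x n - y); rewrite addrA subrK => /le_lt_trans; apply.
  rewrite [e]splitr; apply: ltrD => //.
  exact: lt_le_trans xy (le_trans nk ke).
exists l; split => //; apply: (@closed_closure _ A).
move=> B /Fl FB; have [y [Ay By]] := filter_ex (filterI FA FB).
by exists y.
Qed.

End precompactness.

(** * Completeness of the Lebesgue spaces *)

Section geometric_sequence.
Context {R : realType}.

(** With b = a / (1 - r), the sequences u_n - b r^n and u_n + b r^n are
    respectively nondecreasing and nonincreasing, so they squeeze the limit and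
    give the error estimate at once. *)
Lemma geometric_increments_cvg (u : nat -> R) (a r : R) : 0 < r < 1 ->
  (forall n, `|u n.+1 - u n| <= a * r ^+ n) ->
  exists l : R, u @ \oo --> l /\ forall n, `|l - u n| <= a / (1 - r) * r ^+ n.
Proof.
move=> /andP[r0 r1] ua; set b := a / (1 - r).
have r1' : 0 < 1 - r by rewrite subr_gt0.
have bE n : b * r ^+ n - b * r ^+ n.+1 = a * r ^+ n.
  by rewrite /b exprS; field; rewrite gt_eqF.
pose v n := u n - b * r ^+ n; pose w n := u n + b * r ^+ n.
have b0 : 0 <= b by rewrite divr_ge0 ?(ltW r1')//; have := ua 0%N; rewrite expr0 mulr1; apply: le_trans.
have vw n : v n <= w n.
  have : 0 <= b * r ^+ n by rewrite mulr_ge0 ?exprn_ge0// ltW.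
  by rewrite /v /w; lra.
have ndv : {homo v : n k / (n <= k)%N >-> n <= k}.
  apply/nondecreasing_seqP => n; have := ua n; rewrite ler_norml => /andP[+ _].
  by have := bE n; rewrite /v; lra.
have niw : {homo w : n k / (n <= k)%N >-> k <= n}.
  apply/nonincreasing_seqP => n; have := ua n; rewrite ler_norml => /andP[_].
  by have := bE n; rewrite /w; lra.
have vwk n k : v k <= w n.
  apply: le_trans (ndv _ _ (leq_maxr n k)) _.
  by apply: le_trans (vw _) _; apply: niw; exact: leq_maxl.
have lP n : `|sup (range v) - u n| <= b * r ^+ n.
  rewrite ler_distl; apply/andP; split.
    by apply: ub_le_sup; [exists (w 0%N) => _ [k _ <-]|exists n].
  apply: ge_sup; first by exists (v 0%N), 0%N.
  by move=> _ [k _ <-]; exact: vwk.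
exists (sup (range v)); split=> //.
apply/cvgrPdist_le => e e0.
have : b * r ^+ n @[n --> \oo] --> b * 0.
  by apply: cvgMl_tmp; apply: cvg_expr; rewrite ger0_norm// ltW.
rewrite mulr0 => /cvgrPdist_le/(_ e e0); apply: filterS => n.
rewrite sub0r normrN => bn; apply: le_trans (lP n) _.
exact: le_trans (ler_norm _) bn.
Qed.

End geometric_sequence.

Section Lp_limit.
Context {R : realType} {disp : measure_display} {X : measurableType disp}.
Context (nu : {measure set X -> \bar R}) (p : R).
Hypothesis p_gt0 : 0 < p.
Local Open Scope ereal_scope.

(** Let H be the sum over k of 2^k |f_(k+1) - f_k|^p.  Its integral is finite
    because the increments decay like 4^-k.  Where H is finite, the increments are
    at most (H 2^-k)^(1/p), hence f_n converges with |g - f_n|^p <= c H 2^-n; this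
    pointwise domination by H replaces Fatou's lemma. *)
Lemma Lp_limit_ex (f : nat -> X -> R) :
  (forall n, measurable_fun [set: X] (f n)) ->
  (forall n, \int[nu]_x (`|f n.+1 x - f n x| `^ p)%:E <= (4 ^- n)%:E) ->
  exists (g : X -> R) (c : R), [/\ measurable_fun [set: X] g, (0 <= c)%R &
    forall n, \int[nu]_x (`|g x - f n x| `^ p)%:E <= (c * 2 ^- n)%:E].
Proof.
move=> mf fn.
pose D k x := (2 ^+ k * `|f k.+1 x - f k x| `^ p)%:E.
have D0 k x : 0 <= D k x by rewrite lee_fin mulr_ge0 ?exprn_ge0 ?powR_ge0.
have mpow (g h : X -> R) : measurable_fun [set: X] g -> measurable_fun [set: X] h ->
    measurable_fun [set: X] (fun x => (`|g x - h x| `^ p)%R).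
  move=> mg mh; apply: (measurableT_comp (measurable_powR p)).
  by apply: (measurableT_comp (@normr_measurable R setT)); exact: measurable_funB.
have mD k : measurable_fun [set: X] (D k).
  by apply/measurable_EFinP; apply: measurable_funM => //; exact: mpow.
pose H x := \sum_(k <oo) D k x.
have mH : measurable_fun [set: X] H by exact: ge0_emeasurable_sum.
have H0 x : 0 <= H x by exact: nneseries_ge0.
have DH k x : D k x <= H x.
  apply: le_trans (nneseries_lim_ge k.+1 _) => //.
  by rewrite big_nat_recr//= leeDr// sume_ge0.
have intH : \int[nu]_x H x <= 2%:E.
  rewrite integral_nneseries//.
  apply: (@le_trans _ _ (\sum_(k <oo) (0 + (2 / (2 ^ k.+1)%:R)%:E))); last first.
    have := @epsilon_trick R (fun=> 0) 2%R xpredT (fun _ => lexx _) (ler0n _ _).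
    move=> /le_trans; apply.
    by rewrite eseries0// add0e.
  apply: lee_nneseries => [k _ _|k _]; first exact: integral_ge0.
  rewrite /D; under eq_integral do rewrite EFinM.
  rewrite ge0_integralZl//; last by apply/measurable_EFinP; exact: mpow.
  apply: le_trans (lee_wpmul2l _ (fn k)) _; first by rewrite lee_fin exprn_ge0.
  rewrite -EFinM add0e lee_fin natrX exprS invfM mulVKf ?pnatr_eq0//.
  have -> : (4 : R)%R = (2 * 2)%R by rewrite -natrM.
  by rewrite exprMn invfM mulVKf// expf_neq0.
pose Z := [set x | H x < +oo].
have mZ : measurable Z.
  by rewrite -[Z]setTI; exact: emeasurable_fun_lt.
(* The ratio of the pointwise geometric bound: r^p = 1/2. *)
pose r : R := (2^-1 `^ p^-1)%R.
have r01 : (0 < r < 1)%R.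
  rewrite powR_gt0 ?invr_gt0//= /r.
  have := @gt0_ltr_powR R p^-1; rewrite invr_gt0 => /(_ p_gt0 2^-1%R 1%R).
  by rewrite powR1; apply; rewrite ?nnegrE ?invr_ge0// invf_lt1// ltr1n.
have rp n : ((r ^+ n) `^ p = 2 ^- n)%R.
  rewrite -powR_mulrn ?powR_ge0// /r -2!powRrM.
  have -> : (p^-1 * (n%:R * p) = n%:R)%R by rewrite mulrCA mulVf ?gt_eqF// mulr1.
  by rewrite powR_mulrn ?invr_ge0// exprVn.
have lim_Z x : exists l : R, ((f n x * \1_Z x)%R @[n --> \oo] --> l) /\
    (Z x -> forall n, (`|l - f n x| <= (fine (H x)) `^ p^-1 / (1 - r) * r ^+ n)%R).
  have [Zx|Zx] := pselect (Z x); last first.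
    exists 0%R; split=> //; rewrite indicE memNset//.
    by under eq_fun do rewrite mulr0; exact: cvg_cst.
  have Hx : H x \is a fin_num by rewrite ge0_fin_numE.
  have [|l [fl lf]] := @geometric_increments_cvg R (f ^~ x) (fine (H x) `^ p^-1) r r01.
    move=> n.
    have : (2 ^+ n * `|f n.+1 x - f n x| `^ p <= fine (H x))%R.
      by rewrite -lee_fin fineK//; exact: DH.
    rewrite mulrC -ler_pdivlMr ?exprn_gt0// => h.
    have -> : (`|f n.+1 x - f n x| = (`|f n.+1 x - f n x| `^ p) `^ p^-1)%R.
      by rewrite -powRrM mulfV ?gt_eqF// powRr1.
    have -> : (r ^+ n = (2 ^- n) `^ p^-1)%R.
      by rewrite -rp -powRrM mulfV ?gt_eqF// powRr1// exprn_ge0// powR_ge0.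
    have Hx0 : (0 <= fine (H x))%R by exact: fine_ge0.
    rewrite -powRM// ?invr_ge0 ?exprn_ge0//.
    apply: ge0_ler_powR; rewrite ?nnegrE ?powR_ge0 ?invr_ge0 ?(ltW p_gt0)//.
    by rewrite mulr_ge0// invr_ge0 exprn_ge0.
  exists l; split=> //; rewrite indicE mem_set//.
  by under eq_fun do rewrite mulr1.
have /choice[g gP] := lim_Z.
have mg : measurable_fun [set: X] g.
  apply: (@measurable_fun_cvg _ _ _ setT (fun n x => f n x * \1_Z x)%R) => [n|x _].
    by apply: measurable_funM => //; exact: measurable_indic.
  by have [] := gP x.
have r1 : (0 < 1 - r)%R by case/andP: r01; rewrite subr_gt0.
pose c := ((1 - r)^-1 `^ p)%R.
have c0 : (0 < c)%R by rewrite powR_gt0 ?invr_gt0.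
exists g, (c * 2)%R; split=> // [|n]; first by rewrite mulr_ge0// ltW.
have cn0 : (0 < c * 2 ^- n)%R by rewrite mulr_gt0 ?invr_gt0 ?exprn_gt0.
apply: (@le_trans _ _ (\int[nu]_x ((c * 2 ^- n)%:E * H x))); last first.
  rewrite ge0_integralZl//; last by rewrite lee_fin ltW.
  apply: le_trans (lee_wpmul2l _ intH) _; first by rewrite lee_fin ltW.
  by rewrite -EFinM lee_fin mulrAC.
apply: ge0_le_integral => //.
- by apply/measurable_EFinP; exact: mpow.
- exact: measurable_funeM.
(* Where H is infinite the domination is trivial, so no null set intervenes. *)
move=> x _; have [Zx|] := ltP (H x) +oo; last first.
  rewrite leye_eq => /eqP ->.
  by rewrite gt0_muley ?lte_fin// leey.
have Hx : H x \is a fin_num by rewrite ge0_fin_numE.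
rewrite -(fineK Hx) -EFinM lee_fin.
have [_ /(_ Zx n) gx] := gP x.
have Hx0 : (0 <= fine (H x))%R by exact: fine_ge0.
apply: (@le_trans _ _ ((fine (H x) `^ p^-1 / (1 - r) * r ^+ n) `^ p)%R).
  apply: ge0_ler_powR; rewrite ?nnegrE ?(ltW p_gt0)//.
  exact: le_trans gx.
rewrite powRM ?exprn_ge0 ?powR_ge0//; last first.
  by rewrite divr_ge0 ?powR_ge0// ltW.
rewrite powRM ?powR_ge0 ?invr_ge0 ?(ltW r1)// rp -powRrM mulVf ?gt_eqF// powRr1//.
by rewrite -/c le_eqVlt; apply/orP; left; apply/eqP; ring.
Qed.

End Lp_limit.

Section Lp_space.
Context {R : realType} {d m : nat}.
Context (nu : 'I_m -> {finite_measure set (borelRd R d) -> \bar R}).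
Context {p : R} (p1 : 1 <= p).
Implicit Types (F G : Lp_fun nu p1).

Let p_gt0 : 0 < p. Proof. exact: lt_le_trans p1. Qed.

Definition power_mass F := vintegral nu (fun x i => `|F x ord0 i| `^ p).

Lemma power_mass_ge0 F : 0 <= power_mass F.
Proof. by apply: vintegral_ge0 => x i; exact: powR_ge0. Qed.

Lemma Lp_seminormE F : Lp_seminorm nu p1 F = power_mass F `^ p^-1.
Proof. by []. Qed.

Lemma Lp_seminorm_leP F (a : R) : 0 <= a ->
  (Lp_seminorm nu p1 F <= a) = (power_mass F <= a `^ p).
Proof.
move=> a0; have M0 := power_mass_ge0 F; rewrite Lp_seminormE.
apply/idP/idP => h.
  have -> : power_mass F = (power_mass F `^ p^-1) `^ p.
    by rewrite -powRrM mulVf ?gt_eqF// powRr1.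
  by apply: ge0_ler_powR => //; rewrite ?nnegrE ?powR_ge0// ltW.
have -> : a = (a `^ p) `^ p^-1 by rewrite -powRrM mulfV ?gt_eqF// powRr1.
by apply: ge0_ler_powR => //; rewrite ?nnegrE ?powR_ge0// invr_ge0 ltW.
Qed.

Lemma Lp_class_norm F : `|Lp_class F| = Lp_seminorm nu p1 F.
Proof. exact: seminorm_quot_normE. Qed.

Lemma Lp_classD F G : Lp_class (F + G) = Lp_class F + Lp_class G.
Proof. exact: seminorm_quotD. Qed.

Lemma Lp_classZ a F : Lp_class (a *: F) = a *: Lp_class F.
Proof. by rewrite -[RHS]/(seminorm_quot_scale _ _) seminorm_quot_scaleE. Qed.

Lemma Lp_classB F G : Lp_class (F - G) = Lp_class F - Lp_class G.
Proof. by rewrite -scaleN1r Lp_classD Lp_classZ scaleN1r. Qed.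

Lemma Lp_class_surj (u : Lp nu p1) : exists F, u = Lp_class F.
Proof. by exists (repr u); rewrite /Lp_class reprK. Qed.

Lemma Lp_coord F i : (fun x : borelRd R d => F x ord0 i) \in Lfun (nu i) p%:E.
Proof. by have /asboolP/(_ i) := valP F. Qed.

Lemma Lp_coord_measurable F i :
  measurable_fun [set: borelRd R d] (fun x : borelRd R d => F x ord0 i).
Proof. by have := Lp_coord F i; rewrite inE => /andP[/[!inE]]. Qed.

Lemma Lfun_of_bound i (g : borelRd R d -> R) :
  measurable_fun [set: borelRd R d] g ->
  (\int[nu i]_x (`|g x| `^ p)%:E < +oo)%E -> g \in Lfun (nu i) p%:E.
Proof.
move=> mg gy; rewrite inE/=; apply/andP; split; rewrite inE//=.
by rewrite /finite_norm unlock poweR_lty.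
Qed.

Lemma Lp_of_coord (g : 'I_m -> borelRd R d -> R) :
  (forall i, g i \in Lfun (nu i) p%:E) ->
  {F : Lp_fun nu p1 | forall x i, F x ord0 i = g i x}.
Proof.
move=> gL; suff h : (fun x => \row_i g i x) \in Lp_pred nu p1.
  by exists (MkLp_fun h) => x i; rewrite mxE.
apply/asboolP => i; have -> : (fun x : borelRd R d => (\row_i0 g i0 x) ord0 i) = g i.
  by apply/funext => x; rewrite mxE.
exact: gL.
Qed.

Lemma LpBE F G x i : (F - G) x ord0 i = F x ord0 i - G x ord0 i.
Proof. by rewrite !mxE. Qed.

Lemma Lp_coord_integral_le F i :
  (\int[nu i]_x (`|F x ord0 i| `^ p)%:E <= (power_mass F)%:E)%E.
Proof.
have fin k : (\int[nu k]_x (`|F x ord0 k| `^ p)%:E)%E \is a fin_num.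
  by apply: integrable_fin_num => //; exact: Lp_integrable.
rewrite -(fineK (fin i)) lee_fin /power_mass /vintegral (bigD1 i)//= lerDl.
by apply: sumr_ge0 => k _; apply: Rintegral_ge0 => x _; exact: powR_ge0.
Qed.

Lemma power_mass_le F (c : R) :
  (forall i, (\int[nu i]_x (`|F x ord0 i| `^ p)%:E <= c%:E)%E) ->
  power_mass F <= m%:R * c.
Proof.
move=> Fc; have -> : m%:R * c = \sum_(i < m) c.
  by rewrite sumr_const card_ord mulr_natl.
apply: ler_sum => i _; rewrite -lee_fin; apply: le_trans (Fc i).
by rewrite fineK//; apply: integrable_fin_num => //; exact: Lp_integrable.
Qed.

(** Representatives of the classes converge coordinate by coordinate; the decay
    4^-n of the norms passes to their p-th powers since p >= 1. *)
Lemma Lp_geometric_complete : @geometric_complete R (Lp nu p1).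
Proof.
move=> u uP.
have /choice[F uF] : forall n, exists F, u n = Lp_class F.
  by move=> n; exact: Lp_class_surj.
have F4 n : power_mass (F n.+1 - F n) <= 4 ^- n.
  have h0 : 0 <= 4 ^- n :> R by rewrite invr_ge0 exprn_ge0.
  have := uP n; rewrite !uF -Lp_classB Lp_class_norm Lp_seminorm_leP//.
  move=> /le_trans; apply; have [->|h1] := eqVneq (4 ^- n : R) 0.
    by rewrite powR0// gt_eqF.
  apply: ge1r_powR => //; rewrite lt_neqAle eq_sym h1 h0/=.
  by rewrite invf_le1 ?exprn_gt0// exprn_ege1// ler1n.
have ex i : exists (g : borelRd R d -> R) (c : R),
    [/\ measurable_fun [set: borelRd R d] g, (0 <= c)%R & forall n,
    (\int[nu i]_x (`|g x - F n x ord0 i| `^ p)%:E <= (c * 2 ^- n)%:E)%E].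
  apply: (@Lp_limit_ex _ _ _ (nu i) p p_gt0 (fun n x => F n x ord0 i)) => n.
    exact: Lp_coord_measurable.
  apply: (@le_trans _ _ (power_mass (F n.+1 - F n))%:E); last by rewrite lee_fin.
  apply: le_trans (Lp_coord_integral_le (F n.+1 - F n) i).
  by under [leRHS]eq_integral do rewrite LpBE.
have [g gP] := choice ex; have [c cP] := choice gP => {ex gP}.
have gL i : g i \in Lfun (nu i) p%:E.
  have [mg c0 gc] := cP i.
  have hL : (fun x => g i x - F 0%N x ord0 i) \in Lfun (nu i) p%:E.
    apply: Lfun_of_bound; last by apply: le_lt_trans (gc 0%N) _; rewrite ltry.
    by apply: measurable_funB => //; exact: Lp_coord_measurable.
  have p1e : (1 <= p%:E)%E by rewrite lee_fin.
  have -> : g i = 1 *: (fun x => g i x - F 0%N x ord0 i) +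
      (fun x : borelRd R d => F 0%N x ord0 i).
    by apply/funext => x; rewrite /= scale1r subrK.
  by apply: (Lfun_submod_closed (nu i) p1e).2 => //; exact: Lp_coord.
have [G GE] := Lp_of_coord g gL.
pose c0 := \sum_i c i.
have cc0 i : c i <= c0.
  rewrite /c0 (bigD1 i)//= lerDl; apply: sumr_ge0 => k _.
  by have [] := cP k.
have massG n : power_mass (G - F n) <= m%:R * (c0 * 2 ^- n).
  apply: power_mass_le => i; have [_ _ /(_ n)] := cP i.
  under eq_integral do rewrite -GE -LpBE; move=> /le_trans; apply.
  by rewrite lee_fin ler_wpM2r ?invr_ge0 ?exprn_ge0.
exists (Lp_class G); apply/cvgrPdist_le => e e0.
have : m%:R * c0 * 2^-1 ^+ n @[n --> \oo] --> m%:R * c0 * 0.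
  apply: cvgMl_tmp; apply: cvg_expr; rewrite ger0_norm ?invr_ge0//.
  by rewrite invf_lt1// ltr1n.
rewrite mulr0 => /cvgrPdist_le/(_ (e `^ p) (powR_gt0 _ e0)); apply: filterS => n.
rewrite sub0r normrN => ne; rewrite uF -Lp_classB Lp_class_norm.
rewrite Lp_seminorm_leP ?(ltW e0)//; apply: le_trans (massG n) _.
by apply: le_trans ne; rewrite exprVn mulrA ler_norm.
Qed.

End Lp_space.

(** * Density of bounded continuous functions *)

Lemma ecvg0_ex {R : realType} (u : nat -> \bar R) (e : R) :
  (u @ \oo --> 0%:E)%E -> 0 < e -> exists n, (u n <= e%:E)%E.
Proof.
move=> /fine_cvgP[fu /cvgrPdist_le/(_ e)] /[apply] ue.
have [n [fn un]] := filter_ex (filterI fu ue).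
exists n; rewrite -(fineK fn) lee_fin.
by apply: le_trans (ler_norm _) _; move: un; rewrite sub0r normrN.
Qed.

Section continuous_approximation.
Context {R : realType} {d : nat}.
Context (la : {finite_measure set (borelRd R d) -> \bar R}).
Implicit Types (f g : borelRd R d -> R).

Lemma continuous_borel g :
  continuous (g : 'rV[R]_d -> R) -> measurable_fun [set: borelRd R d] g.
Proof.
move=> cg; apply: (measurability _ (RGenOInfty.measurableE R)) => // _ [_ [a ->] <-].
rewrite setTI; apply: sub_sigma_algebra.
by move/continuousP : cg; apply; exact: interval_open.
Qed.

Definition L1dist f g := (\int[la]_x (`|f x - g x|)%:E)%E.

(** Approximation is asked in L1, where errors add up; for functions bounded by a
    common constant it yields approximation in every Lp. *)
Definition approximable f := measurable_fun [set: borelRd R d] f /\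
  forall e : R, 0 < e -> exists g, [/\ continuous (g : 'rV[R]_d -> R),
    exists M, forall x, `|g x| <= M & (L1dist f g <= e%:E)%E].

Lemma measurable_dist f g : measurable_fun [set: borelRd R d] f ->
  measurable_fun [set: borelRd R d] g ->
  measurable_fun [set: borelRd R d] (fun x => (`|f x - g x|)%:E).
Proof.
move=> mf mg; apply/measurable_EFinP.
by apply: (measurableT_comp (@normr_measurable R setT)); exact: measurable_funB.
Qed.

(** The triangle inequality in the form used for 1-Lipschitz combinations of two
    functions. *)
Lemma L1dist_le (f1 f2 g1 g2 h1 h2 : borelRd R d -> R) :
  measurable_fun [set: borelRd R d] f1 -> measurable_fun [set: borelRd R d] f2 ->
  measurable_fun [set: borelRd R d] g1 -> measurable_fun [set: borelRd R d] g2 ->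
  measurable_fun [set: borelRd R d] h1 -> measurable_fun [set: borelRd R d] h2 ->
  (forall x, `|h1 x - h2 x| <= `|f1 x - f2 x| + `|g1 x - g2 x|) ->
  (L1dist h1 h2 <= L1dist f1 f2 + L1dist g1 g2)%E.
Proof.
move=> mf1 mf2 mg1 mg2 mh1 mh2 h; rewrite /L1dist -ge0_integralD//; last 2 first.
- exact: measurable_dist.
- exact: measurable_dist.
apply: ge0_le_integral => //.
- exact: measurable_dist.
- by apply: emeasurable_funD; exact: measurable_dist.
- by move=> x _; rewrite -EFinD lee_fin.
Qed.

Lemma approximable_continuous g : continuous (g : 'rV[R]_d -> R) ->
  (exists M, forall x, `|g x| <= M) -> approximable g.
Proof.
move=> cg bg; split; first exact: continuous_borel.
move=> e e0; exists g; split=> //; rewrite /L1dist.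
by under eq_integral do rewrite subrr normr0; rewrite integral0 lee_fin ltW.
Qed.

Lemma approximable_lim f (f_ : nat -> borelRd R d -> R) :
  measurable_fun [set: borelRd R d] f -> (forall n, approximable (f_ n)) ->
  (forall e : R, 0 < e -> exists n, (L1dist f (f_ n) <= e%:E)%E) ->
  approximable f.
Proof.
move=> mf af lim; split => // e e0.
have e2 : 0 < e / 2 by rewrite divr_gt0.
have [n fn] := lim _ e2; have [mfn /(_ _ e2)[g [cg bg gn]]] := af n.
have mg := continuous_borel _ cg.
exists g; split=> //; rewrite [e]splitr EFinD; apply: le_trans (leeD fn gn).
apply: L1dist_le => // x.
by have := ler_normD (f x - f_ n x) (f_ n x - g x); rewrite addrA subrK.
Qed.

Lemma approximable_dominated f (f_ : nat -> borelRd R d -> R) :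
  (forall n, approximable (f_ n)) -> (forall n x, `|f_ n x| <= 1) ->
  (forall x, f_ ^~ x @ \oo --> f x) -> approximable f.
Proof.
move=> af bf ff; have mf_ n : measurable_fun [set: borelRd R d] (f_ n) by have [] := af n.
have mf : measurable_fun [set: borelRd R d] f.
  by apply: (measurable_fun_cvg mf_) => x _; exact: ff.
apply: (approximable_lim _ _ mf af) => e e0.
have [||||| _ + _] := @dominated_convergence _ _ R la setT measurableT
  (fun n x => (f_ n x)%:E) (EFin \o f) (cst 1%:E).
- by move=> n; apply/measurable_EFinP.
- exact/measurable_EFinP.
- by apply: aeW => x _; apply: cvg_EFin; [exact: nearW|exact: ff].
- exact: finite_measure_integrable_cst.
- by apply: aeW => x n _; rewrite lee_fin.
move=> /(ecvg0_ex _ e) /(_ e0)[n fn]; exists n; apply: le_trans fn.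
rewrite /L1dist le_eqVlt; apply/orP; left; apply/eqP.
by apply: eq_integral => x _; rewrite distrC.
Qed.

Lemma approximable_comb2 (phi : R -> R -> R) f g :
  (forall a b a' b', `|phi a b - phi a' b'| <= `|a - a'| + `|b - b'|) ->
  measurable_fun [set: borelRd R d] (fun x => phi (f x) (g x)) ->
  approximable f -> approximable g -> approximable (fun x => phi (f x) (g x)).
Proof.
move=> lip mphi [mf af] [mg ag]; split=> // e e0.
have e2 : 0 < e / 2 by rewrite divr_gt0.
have [f' [cf [M fM] ff]] := af _ e2; have [g' [cg [N gN] gg]] := ag _ e2.
have c : continuous (fun x : 'rV[R]_d => phi (f' x) (g' x)).
  move=> x; pose nF := @nbhs_filter _ x.
  have cvgP (h : 'rV[R]_d -> R) := @cvgrPdist_le R R _ (nbhs x) nF h (h x).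
  apply/(cvgP (fun x => phi (f' x) (g' x))) => eps eps0.
  have eps2 : 0 < eps / 2 by rewrite divr_gt0.
  have h1 := (cvgP f').1 (cf x) _ eps2; have h2 := (cvgP g').1 (cg x) _ eps2.
  apply: (@filterS2 _ _ nF _ _ _ _ h1 h2) => y fy gy; apply: le_trans (lip _ _ _ _) _.
  by rewrite [eps]splitr lerD.
exists (fun x => phi (f' x) (g' x)); split=> //.
  exists (`|phi 0 0| + (M + N)) => x; apply: (@le_trans _ _ (`|phi 0 0| + (`|f' x| + `|g' x|))).
    have := lip (f' x) (g' x) 0 0; rewrite !subr0.
    have := ler_normD (phi 0 0) (phi (f' x) (g' x) - phi 0 0); rewrite subrKC.
    by lra.
  by rewrite lerD2l lerD.
rewrite [e]splitr EFinD; apply: le_trans (leeD ff gg).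
by apply: L1dist_le => //; exact: continuous_borel.
Qed.

(** The indicator of an open set O is the pointwise limit of Urysohn functions
    separating the complement of O from the points at distance at least 1/(n+1)
    from it. *)
Lemma approximable_indic_open (O : set 'rV[R]_d) : open O ->
  approximable (\1_O : borelRd R d -> R).
Proof.
move=> oO; pose F n := [set x : 'rV[R]_d | ball x (n.+1%:R^-1) `<=` O].
have sepF n : uniform_separator (~` O) (F n).
  apply: uniform_separatorW; exists [set xy | ball xy.1 (n.+1%:R^-1 : R) xy.2].
    by rewrite -entourage_ballE; exists (n.+1%:R^-1 : R) => //=; rewrite invr_gt0.
  apply/seteqP; split => // -[a b]/= [[Oa Fb] ab].
  by apply: Oa; apply: Fb; exact: ball_sym.
pose g n : borelRd R d -> R := Urysohn (~` O) (F n).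
have g01 n x : 0 <= g n x <= 1.
  by have := @Urysohn_range _ R (~` O) (F n) (g n x); rewrite /= in_itv/=; apply; exists x.
apply: (@approximable_dominated _ g) => [n|n x|x].
- apply: approximable_continuous; first exact: Urysohn_continuous.
  by exists 1 => x; have /andP[g0 g1] := g01 n x; rewrite ger0_norm.
- by have /andP[g0 g1] := g01 n x; rewrite ger0_norm.
have [Ox|Ox] := pselect (O x); last first.
  rewrite indicE memNset//; have -> : g ^~ x = cst 0; last exact: cvg_cst.
  by apply/funext => n; apply: (Urysohn_sub0 (sepF n)); exists x.
rewrite indicE mem_set//; apply: cvg_near_cst.
have /nbhs_ballP[e /= e0 eO] := open_nbhs_nbhs (conj oO Ox).
exists (Num.bound e^-1) => // n /= nb.
apply: (Urysohn_sub1 (sepF n)); exists x => // y xy; apply: eO.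
apply: le_ball xy; rewrite -[leRHS]invrK lef_pV2 ?posrE ?invr_gt0//.
apply: le_trans (ltW (archi_boundP _)) _; first by rewrite invr_ge0 ltW.
by rewrite ler_nat (leq_trans nb).
Qed.

(** The sets with approximable indicator contain the open sets and form a
    sigma-algebra: 1 - 1_A and max(1_A, 1_B) are 1-Lipschitz combinations, and
    countable unions are dominated limits of finite ones. *)
Lemma approximable_indic (A : set (borelRd R d)) : measurable A ->
  approximable (\1_A : borelRd R d -> R).
Proof.
move: A; apply: smallest_sub; last exact: approximable_indic_open.
have idxU (A B : set (borelRd R d)) : approximable (\1_A : borelRd R d -> R) ->
    approximable (\1_B : borelRd R d -> R) ->
    approximable (\1_(A `|` B) : borelRd R d -> R).
  move=> aA aB; have -> : (\1_(A `|` B) : borelRd R d -> R) =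
      (fun x => Num.max (\1_A x) (\1_B x)).
    apply/funext => x; rewrite !indicE in_setU.
    by case: (x \in A); case: (x \in B); rewrite ?maxxx//= /Num.max ?ltr01 ?ltr10.
  apply: (@approximable_comb2 (fun a b => Num.max a b)) => //.
    move=> a b a' b'; rewrite ler_norml; apply/andP.
    have := ler_norm (a - a'); have := ler_norm (b - b').
    have := lerNnormlW (lexx `|a - a'|); have := lerNnormlW (lexx `|b - b'|).
    by case: (leP a b); case: (leP a' b') => ? ? ? ? ? ?; split; lra.
  by apply: measurable_maxr; [have [] := aA|have [] := aB].
split.
- by apply: approximable_indic_open; exact: open0.
- move=> A aA; have -> : (\1_(setT `\` A) : borelRd R d -> R) = (fun x => 1 - \1_A x).
    apply/funext => x; rewrite !indicE in_setD in_setT/=.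
    by case: (x \in A); rewrite /= ?subrr ?subr0.
  apply: (@approximable_comb2 (fun a b => 1 - b) (\1_A) (\1_A)) => //.
    move=> a b a' b'; rewrite [X in `|X|](_ : _ = b' - b); last by ring.
    by rewrite distrC lerDr.
  by apply: measurable_funB => //; have [] := aA.
- move=> A aA; pose B n := \big[setU/set0]_(k < n) A k.
  apply: (@approximable_dominated _ (fun n => \1_(B n))) => [n|n x|x].
  + rewrite /B; elim: n => [|n IHn].
      by rewrite big_ord0; apply: approximable_indic_open; exact: open0.
    by rewrite big_ord_recr/=; exact: idxU.
  + by rewrite indicE; case: (x \in B n); rewrite ?normr1 ?normr0.
  + rewrite indicE; have [/set_mem[k _ Ak]|/negP nA] := boolP (x \in \bigcup_k A k).
      apply: cvg_near_cst; exists k.+1 => // n /= kn; rewrite indicE mem_set//.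
      by rewrite /B -bigcup_mkord; exists k.
    have -> : (fun n => \1_(B n) x) = cst (0 : R); last exact: cvg_cst.
    apply/funext => n; rewrite indicE memNset// /B -bigcup_mkord => -[k _ Ak].
    by apply: nA; apply: mem_set; exists k.
Qed.

End continuous_approximation.

Section Lp_density.
Import HBSimple.
Context {R : realType} {d : nat}.
Context (la : {finite_measure set (borelRd R d) -> \bar R}).

Lemma approximableD (f g : borelRd R d -> R) :
  approximable la f -> approximable la g -> approximable la (fun x => f x + g x).
Proof.
move=> af ag; apply: (@approximable_comb2 _ _ _ (fun a b => a + b)) => //.
  by move=> a b a' b'; rewrite opprD addrACA; exact: ler_normD.
by apply: measurable_funD; [have [] := af|have [] := ag].
Qed.

Lemma approximableZ (c : R) (f : borelRd R d -> R) :
  approximable la f -> approximable la (fun x => c * f x).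
Proof.
move=> [mf af]; have mcf : measurable_fun [set: borelRd R d] (fun x => c * f x).
  by apply: measurable_funM.
split=> // e e0.
have c1 : 0 < `|c| + 1 by rewrite ltr_wpDl.
have ec : 0 < e / (`|c| + 1) by rewrite divr_gt0.
have [g [cg [M gM] fg]] := af _ ec.
exists (fun x => c * g x); split.
- by move=> x; apply: (@continuousM R 'rV[R]_d (cst c) g x); [exact: cst_continuous|exact: cg].
- by exists (`|c| * M) => x; rewrite normrM ler_wpM2l.
have -> : L1dist la (fun x => c * f x) (fun x => c * g x) =
    (`|c|%:E * L1dist la f g)%E.
  rewrite -ge0_integralZl//; first by apply: eq_integral => x _; rewrite -mulrBr normrM.
  by apply: measurable_dist => //; exact: continuous_borel.
apply: le_trans (lee_wpmul2l _ fg) _; first by rewrite lee_fin.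
by rewrite -EFinM lee_fin mulrA ler_pdivrMr// mulrC ler_wpM2l ?(ltW e0)// lerDl.
Qed.

Lemma approximable_sfun (f : {sfun borelRd R d >-> R}) : approximable la f.
Proof.
have -> : (f : borelRd R d -> R) = (fun x =>
    \sum_(y <- finmap.enum_fset (fset_set (range f))) y * \1_(f @^-1` [set y]) x).
  by apply/funext => x; rewrite [LHS]fimfunE fsbig_finite.
elim: (finmap.enum_fset _) => [|y s IHs].
  have -> : (fun x : borelRd R d => \sum_(y <- [::]) y * \1_(f @^-1` [set y]) x) =
      cst 0 by apply/funext => x; rewrite big_nil.
  apply: approximable_continuous; first exact: cst_continuous.
  by exists 0 => x; rewrite normr0.
have -> : (fun x => \sum_(z <- y :: s) z * \1_(f @^-1` [set z]) x) =
    (fun x => y * \1_(f @^-1` [set y]) x + \sum_(z <- s) z * \1_(f @^-1` [set z]) x).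
  by apply/funext => x; rewrite big_cons.
apply: approximableD => //; apply: approximableZ; apply: approximable_indic.
exact: measurable_sfunP.
Qed.

Lemma approximable_integrable (f : borelRd R d -> R) :
  la.-integrable [set: borelRd R d] (EFin \o f) -> approximable la f.
Proof.
move=> intf; have mf : measurable_fun [set: borelRd R d] f.
  by apply/measurable_EFinP; exact: measurable_int intf.
have [g [_ _ gf]] := approximation_sfun_integrable measurableT intf.
apply: (approximable_lim _ _ g mf) => [n|e e0]; first exact: approximable_sfun.
exact: (ecvg0_ex _ _ gf e0).
Qed.

Lemma measurable_clamp (l : R) (f : borelRd R d -> R) :
  measurable_fun [set: borelRd R d] f ->
  measurable_fun [set: borelRd R d] (fun x => clamp l (f x)).
Proof.
move=> mf; apply: (@measurable_maxr _ _ R setT (cst (- l)) (fun x => Num.min l (f x))) => //.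
exact: (@measurable_minr _ _ R setT (cst l) f).
Qed.

(** Truncate [f] at a height l, approximate the truncation in L1 by a continuous
    [g], and truncate [g] at the same height: the L1 distance does not increase,
    and since both functions are bounded by l, the p-th power of their difference
    is at most (2 l)^(p-1) times the difference itself. *)
Lemma continuous_dense_Lp (p e : R) (f : borelRd R d -> R) : 1 <= p -> 0 < e ->
  measurable_fun [set: borelRd R d] f ->
  la.-integrable [set: borelRd R d] (EFin \o (fun x => `|f x| `^ p)) ->
  exists g : borelRd R d -> R, [/\ continuous (g : 'rV[R]_d -> R),
    exists M, forall x, `|g x| <= M &
    (\int[la]_x (`|f x - g x| `^ p)%:E <= e%:E)%E].
Proof.
move=> p1 e0 mf intf; have p0 : 0 < p by exact: lt_le_trans p1.
have mpow (u v : borelRd R d -> R) : measurable_fun [set: borelRd R d] u ->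
    measurable_fun [set: borelRd R d] v ->
    measurable_fun [set: borelRd R d] (fun x => (`|u x - v x| `^ p)%:E).
  move=> mu mv; apply/measurable_EFinP; apply: (measurableT_comp (measurable_powR p)).
  by apply: (measurableT_comp (@normr_measurable R setT)); exact: measurable_funB.
pose e1 := e / (2 * 2 `^ p).
have q0 : 0 < 2 `^ p :> R by exact: powR_gt0.
have e10 : 0 < e1 by rewrite divr_gt0// mulr_gt0.
have [||||| _ + _] := @dominated_convergence _ _ R la setT measurableT
  (fun n x => (`|f x - clamp n%:R (f x)| `^ p)%:E) (cst 0%:E)
  (EFin \o (fun x => `|f x| `^ p)).
- by move=> n; apply: mpow => //; exact: measurable_clamp.
- exact: measurable_cst.
- apply: aeW => x _; apply: cvg_near_cst; exists (Num.bound `|f x|) => // n /= nu.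
  rewrite clamp_id ?subrr ?normr0 ?powR0 ?gt_eqF//.
  apply: le_trans (ltW (archi_boundP (normr_ge0 (f x)))) _.
  by rewrite ler_nat.
- exact: intf.
- apply: aeW => x n _; rewrite /= lee_fin ger0_norm ?powR_ge0//.
  apply: ge0_ler_powR; rewrite ?nnegrE ?(ltW p0)//.
  by rewrite clamp_excess//; exact: excess_le.
move=> /(ecvg0_ex _ e1) /(_ e10)[n fn].
pose l : R := n%:R; have l0 : 0 <= l by rewrite ler0n.
have mc := measurable_clamp l f mf.
have intc : la.-integrable [set: borelRd R d] (EFin \o (fun x => clamp l (f x))).
  apply: measurable_bounded_integrable => //.
    by rewrite -ge0_fin_numE// fin_num_measure.
  exists l; split; first exact: num_real.
  by move=> M /ltW lM x _ /=; apply: le_trans lM; exact: clamp_norm.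
have B1 : 0 < (2 * l) `^ (p - 1) + 1 by rewrite ltr_wpDl ?powR_ge0.
have [_ /(_ (e1 / ((2 * l) `^ (p - 1) + 1)))[|g [cg [M gM] cfg]]] :=
  approximable_integrable _ intc; first by rewrite divr_gt0.
have mg := continuous_borel _ cg.
exists (fun x => clamp l (g x)); split.
- move=> x; apply: (@continuous_comp _ _ _ g (clamp l)); first exact: cg.
  exact: clamp_continuous.
- by exists l => x; exact: clamp_norm.
have mcg := measurable_clamp l g mg.
apply: (@le_trans _ _ (\int[la]_x ((2 `^ p)%:E * ((`|f x - clamp l (f x)| `^ p)%:E +
    (`|clamp l (f x) - clamp l (g x)| `^ p)%:E)))%E).
  apply: ge0_le_integral => //.
  - exact: mpow.
  - by apply: measurable_funeM; apply: emeasurable_funD; exact: mpow.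
  - move=> x _; rewrite -EFinD -EFinM lee_fin.
    have := powR_normD_le p (f x - clamp l (f x)) (clamp l (f x) - clamp l (g x)) (ltW p0).
    by rewrite addrA subrK.
rewrite ge0_integralZl//; last 2 first.
- by apply: emeasurable_funD; exact: mpow.
- by move=> x _; rewrite adde_ge0// lee_fin powR_ge0.
rewrite ge0_integralD//; [|exact: mpow|exact: mpow].
have fn' : (\int[la]_x (`|f x - clamp l (f x)| `^ p)%:E <= e1%:E)%E.
  apply: le_trans fn; rewrite le_eqVlt; apply/orP; left; apply/eqP.
  by apply: eq_integral => x _; rewrite /= subr0 (ger0_norm (powR_ge0 _ _)).
have gn' : (\int[la]_x (`|clamp l (f x) - clamp l (g x)| `^ p)%:E <= e1%:E)%E.
  apply: (@le_trans _ _ (\int[la]_x (((2 * l) `^ (p - 1))%:E *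
      (`|clamp l (f x) - g x|)%:E))%E).
    apply: ge0_le_integral => //.
    - exact: mpow.
    - by apply: measurable_funeM; exact: measurable_dist.
    - move=> x _; rewrite -EFinM lee_fin.
      set u := `|clamp l (f x) - clamp l (g x)|.
      have u0 : 0 <= u by exact: normr_ge0.
      rewrite -(mulr_powRB1 u0 p0) mulrC.
      apply: ler_pM; rewrite ?powR_ge0//.
        apply: ge0_ler_powR; rewrite ?nnegrE ?subr_ge0 ?mulr_ge0//.
        have := ler_normB (clamp l (f x)) (clamp l (g x)) => /le_trans; apply.
        by have := clamp_norm l (f x) l0; have := clamp_norm l (g x) l0; lra.
      have cc : clamp l (clamp l (f x)) = clamp l (f x).
        exact: clamp_id (clamp_norm _ _ l0).
      by have := clamp_lipschitz l (clamp l (f x)) (g x) l0; rewrite cc.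
  rewrite ge0_integralZl//; [|exact: measurable_dist|by rewrite lee_fin powR_ge0].
  apply: le_trans (lee_wpmul2l _ cfg) _; first by rewrite lee_fin powR_ge0.
  rewrite -EFinM lee_fin mulrA ler_pdivrMr//.
  by rewrite mulrC ler_wpM2l ?(ltW e10)// lerDl.
apply: le_trans (lee_wpmul2l _ (leeD fn' gn')) _; first by rewrite lee_fin ltW.
rewrite -EFinD -EFinM lee_fin le_eqVlt; apply/orP; left; apply/eqP.
by rewrite /e1; field; rewrite gt_eqF.
Qed.

End Lp_density.

Section Lp_density_vector.
Context {R : realType} {d m : nat}.
Context (nu : 'I_m -> {finite_measure set (borelRd R d) -> \bar R}).
Context {p : R} (p1 : 1 <= p).

Lemma Cb_dense_Lp (F : Lp_fun nu p1) (e : R) : 0 < e ->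
  exists f : Cb R d m, `|Lp_class F - Cb_to_Lp nu p1 f| <= e.
Proof.
move=> e0; have m0 : 0 < m%:R + 1 :> R by rewrite ltr_wpDl.
have p0 : 0 < p by exact: lt_le_trans p1.
pose e1 := e `^ p / (m%:R + 1).
have e10 : 0 < e1 by rewrite divr_gt0// powR_gt0.
have ex i := continuous_dense_Lp (nu i) p e1 _ p1 e10 (Lp_coord_measurable nu p1 F i)
  (Lp_integrable F i).
have [g gP] := choice ex.
have [f fE] : {f : Cb R d m | forall x i, f x ord0 i = g i x}.
  apply: Cb_of_coord => [i|]; first by have [] := gP i.
  have bg i : exists M, forall x, `|g i x| <= M by have [] := gP i.
  have [M gM] := choice bg; exists (\sum_i `|M i|) => i x.
  apply: le_trans (gM i x) _; apply: le_trans (ler_norm _) _.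
  by rewrite (bigD1 i)//= lerDl sumr_ge0.
exists f; rewrite /Cb_to_Lp -Lp_classB Lp_class_norm Lp_seminorm_leP ?(ltW e0)//.
apply: (@le_trans _ _ (m%:R * e1)).
  apply: power_mass_le => i; have [_ _] := gP i; apply: le_trans.
  rewrite le_eqVlt; apply/orP; left; apply/eqP.
  by apply: eq_integral => x _; rewrite LpBE fE.
by rewrite /e1 mulrA ler_pdivrMr// mulrC ler_wpM2l ?powR_ge0// lerDl.
Qed.

End Lp_density_vector.

(** * From bounded continuous functions to the Lebesgue spaces *)

Section Cb_in_Lp.
Context {R : realType} {d m : nat}.
Context (nu : 'I_m -> {finite_measure set (borelRd R d) -> \bar R}).
Context {p : R} (p1 : 1 <= p).
Implicit Types (f g : Cb R d m).

Let p_gt0 : 0 < p. Proof. exact: lt_le_trans p1. Qed.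

Lemma Cb_to_Lp_linear a f g : Cb_to_Lp nu p1 (a *: f + g) =
  a *: Cb_to_Lp nu p1 f + Cb_to_Lp nu p1 g.
Proof.
rewrite /Cb_to_Lp -Lp_classZ -Lp_classD; congr Lp_class.
exact: val_inj.
Qed.

Lemma Cb_to_LpB f g : Cb_to_Lp nu p1 (f - g) = Cb_to_Lp nu p1 f - Cb_to_Lp nu p1 g.
Proof. by rewrite -scaleN1r addrC Cb_to_Lp_linear scaleN1r addrC. Qed.

Lemma Cb_to_Lp_norm_leP f (a : R) : 0 <= a -> (`|Cb_to_Lp nu p1 f| <= a) =
  (vintegral nu (fun x i => `|f x ord0 i| `^ p) <= a `^ p).
Proof. by move=> a0; rewrite Lp_class_norm Lp_seminorm_leP. Qed.

Lemma Cb_to_Lp_bounded : exists2 c : R, 0 <= c &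
  forall f, `|Cb_to_Lp nu p1 f| <= c * `|f|.
Proof.
pose M := vintegral nu (fun _ _ => 1).
have M0 : 0 <= M by exact: vintegral_ge0.
exists (M `^ p^-1); first exact: powR_ge0.
move=> f; rewrite Cb_to_Lp_norm_leP ?mulr_ge0 ?powR_ge0//.
rewrite powRM ?powR_ge0// -powRrM mulVf ?gt_eqF// powRr1// mulrC /M -vintegral_cst.
apply: le_vintegral => [||x i].
- exact: vintegrable_powR (ltW p_gt0).
- exact: vintegrable_cst.
- by apply: ge0_ler_powR; rewrite ?nnegrE ?(ltW p_gt0)//; exact: Cb_coord_le.
Qed.

Lemma Cb_to_Lp_continuous : continuous (Cb_to_Lp nu p1).
Proof.
have [c c0 cf] := Cb_to_Lp_bounded; move=> f; pose nF := @nbhs_filter _ f.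
apply/(@cvgrPdist_le R (Lp nu p1) _ (nbhs f) nF) => e e0.
have c1 : 0 < c + 1 by rewrite ltr_wpDl.
have ec : 0 < e / (c + 1) by rewrite divr_gt0.
apply: (@filterS _ _ nF _ _ _ (nbhsx_ballx f _ ec)) => g; rewrite -ball_normE/= => fg.
rewrite -Cb_to_LpB; apply: le_trans (cf _) _.
apply: le_trans (ler_wpM2l c0 (ltW fg)) _.
by rewrite mulrA ler_pdivrMr// mulrC ler_wpM2l ?(ltW e0)// lerDl.
Qed.

End Cb_in_Lp.

Lemma Cb_to_L1_norm {R : realType} {d m : nat}
    (nu : 'I_m -> {finite_measure set (borelRd R d) -> \bar R}) (p1 : 1 <= 1 :> R)
    (f : Cb R d m) : `|Cb_to_Lp nu p1 f| = L1norm nu f.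
Proof.
rewrite Lp_class_norm Lp_seminormE invr1 powRr1; last exact: power_mass_ge0.
by apply: eq_bigr => i _; apply: eq_Rintegral => x _; rewrite powRr1.
Qed.

(** Each image [Tp u] is close to the image in Lp of [T (Cb_clamp K f)], with [f]
    bounded continuous and close to [u]; these lie in the continuous image of a
    compact set of continuous functions.  The height [K] depends only on the
    precision and on the bound of the set [A]. *)
Lemma compact_Cb_compact_Lp {R : realType} {d m : nat}
    (nu mu : 'I_m -> {finite_measure set (borelRd R d) -> \bar R})
    (T : Cb R d m -> Cb R d m) (one1 : 1 <= 1 :> R)
    (T1 : Lp nu one1 -> Lp mu one1) (p : R) (p1 : 1 <= p) (Tp : Lp nu p1 -> Lp mu p1) :
  bounded_linear_operator T1 ->
  (forall f, T1 (Cb_to_Lp nu one1 f) = Cb_to_Lp mu one1 (T f)) ->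
  bounded_linear_operator Tp ->
  (forall f, Tp (Cb_to_Lp nu p1 f) = Cb_to_Lp mu p1 (T f)) ->
  1 < p -> compact_operator T -> compact_operator Tp.
Proof.
move=> [T1lin [C T1C]] T1E [Tplin [L TpL]] TpE p_gt1 cptT.
have p_gt0 : 0 < p by exact: (lt_le_trans ltr01 p1).
have T_L1 f : L1norm mu (T f) <= `|C| * L1norm nu f.
  rewrite -!(Cb_to_L1_norm _ one1) -T1E; apply: le_trans (T1C _) _.
  by apply: ler_wpM2r => //; exact: ler_norm.
have T1lin' a (u v : Lp nu one1) : T1 (a *: u + v) = a *: T1 u + T1 v.
  exact: T1lin.
have T_lin a f g : L1norm mu (T (a *: f + g) - (a *: T f + T g)) = 0.
  have TE : Cb_to_Lp mu one1 (T (a *: f + g)) =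
      a *: Cb_to_Lp mu one1 (T f) + Cb_to_Lp mu one1 (T g).
    rewrite -(T1E f) -(T1E g) -(T1E (a *: f + g)).
    by rewrite (Cb_to_Lp_linear nu one1 a f g); exact: T1lin'.
  rewrite -(Cb_to_L1_norm _ one1) (Cb_to_LpB mu one1) TE.
  by rewrite (Cb_to_Lp_linear mu one1 a (T f) (T g)) subrr normr0.
have TpB u v : Tp (u - v) = Tp u - Tp v.
  exact: (zmod_morphism_linear Tplin).
move=> A [M0 [_ AM0]].
pose M := `|M0| + 1.
have AM u : A u -> `|u| <= M.
  by apply: AM0; rewrite (le_lt_trans (ler_norm _))// ltrDl.
have M_ge0 : 0 <= M by rewrite addr_ge0.
apply: precompact_approx; first exact: Lp_geometric_complete.
move=> e e0; have e2 : 0 < e / 2 by rewrite divr_gt0.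
have [K K0 tail] := compact_tail nu mu T `|C| T_L1 T_lin (normr_ge0 _) cptT
  p ((M + 1) `^ p) ((e / 2) `^ p) p_gt1 (powR_ge0 _ _) (powR_gt0 _ e2).
exists (Cb_to_Lp mu p1 @` closure (T @` [set f : Cb R d m | `|f| <= K])).
  apply: continuous_compact.
    by apply: continuous_subspaceT; exact: Cb_to_Lp_continuous.
  exact: (compact_bounded_image T cptT _ K).
move=> _ [u Au <-]; have [F uF] := Lp_class_surj nu p1 u.
have L1_gt0 : 0 < `|L| + 1 by rewrite ltr_wpDl.
pose eta := Num.min 1 (e / 2 / (`|L| + 1)).
have eta0 : 0 < eta by rewrite lt_min ltr01 divr_gt0.
have [f uf] := Cb_dense_Lp nu p1 F eta eta0; rewrite -uF in uf.
exists (Cb_to_Lp mu p1 (T (Cb_clamp K f))).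
  apply: imageP; apply: subset_closure; apply: imageP.
  exact: (Cb_clamp_norm K f (ltW K0)).
have := ler_normD (Tp u - Tp (Cb_to_Lp nu p1 f))
  (Tp (Cb_to_Lp nu p1 f) - Cb_to_Lp mu p1 (T (Cb_clamp K f))).
rewrite addrA subrK => /le_trans; apply; rewrite [leRHS]splitr; apply: lerD.
  rewrite -TpB; apply: le_trans (TpL _) _.
  apply: (@le_trans _ _ ((`|L| + 1) * eta)).
    apply: (@le_trans _ _ ((`|L| + 1) * `|u - Cb_to_Lp nu p1 f|)).
      by rewrite ler_wpM2r// (le_trans (ler_norm _))// lerDl.
    by rewrite ler_wpM2l// ltW.
  by rewrite mulrC -ler_pdivlMr// ge_min lexx orbT.
rewrite -(TpE (Cb_clamp K f)) -TpB -Cb_to_LpB TpE Cb_to_Lp_norm_leP ?(ltW e2)//.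
apply: tail; rewrite -(Cb_to_Lp_norm_leP nu p1) ?addr_ge0//.
have := ler_normB u (u - Cb_to_Lp nu p1 f); rewrite subKr => /le_trans; apply.
apply: lerD; first exact: AM.
by apply: le_trans uf _; rewrite ge_min lexx.
Qed.

Theorem theorem5p6 (R : realType) (d m : nat) (I : set R) (alpha : R)
  (q : 'I_m -> R -> 'rV[R]_d -> 'M[R]_d)
  (b : 'I_m -> R -> 'rV[R]_d -> 'rV[R]_d)
  (C : R -> 'rV[R]_d -> 'M[R]_m)
  (G : R -> R -> Cb R d m -> Cb R d m)
  (mu : R -> 'I_m -> {finite_measure set (borelRd R d) -> \bar R})
  (Gp : forall (p : R) (p1 : 1 <= p) (t s : R),
    Lp (mu s) p1 -> Lp (mu t) p1)
  (t0 s : R) :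
  (0 < d)%N -> (0 < m)%N ->
  (exists a : R, I = `]a, +oo[%classic) \/ I = [set: R] ->
  standing_assumptions I q b C alpha ->
  evolution_operator I q b C alpha G ->
  evolution_system_of_measures I G mu ->
  Lp_extension I G Gp ->
  I s -> I t0 -> s < t0 ->
  compact_operator (G t0 s) ->
  forall (p : R) (p1 : 1 <= p), 1 < p -> compact_operator (Gp p p1 t0 s).
Proof.
move=> _ _ _ _ _ _ ext Is It0 st0 cptG p p1 p_gt1.
have [bl1 ext1] := ext 1 (lexx 1) t0 s Is It0 st0.
have [blp extp] := ext p p1 t0 s Is It0 st0.
exact: (compact_Cb_compact_Lp _ _ _ _ _ _ _ _ bl1 ext1 blp extp).
Qed.
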